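(* Let $k\ge 2$, $r\ge 1$ and $n_1,\ldots,n_k$ be integers with $n_i\ge r$ for all $i\in[k]$, and let $\mathscr{F}\subseteq \mathcal{K}_r(n_1,\ldots,n_k)$ be an intersecting family of $r$-matchings. Then \[ |\mathscr{F}|\le \frac{(n_1-1)_{r-1}\cdots(n_k-1)_{r-1}}{(r-1)!}. \] Furthermore, equality is attained if and only if $\mathscr{F}$ is a star of $\mathcal{K}_r(n_1,\ldots,n_k)$.
   Context: For a positive integer $n$, $[n]=\{1,\ldots,n\}$. For non-negative integers $b\le a$, $(a)_b=\frac{a!}{(a-b)!}$. $\mathcal{K}(n_1,\ldots,n_k)$ denotes the complete $k$-partite $k$-graph with parts $[n_1],\ldots,[n_k]$ (regarded as disjoint); its edges are identified with the $k$-tuples $(x_1,\ldots,x_k)\in[n_1]\times\cdots\times[n_k]$. An $r$-matching is a set of $r$ pairwise vertex-disjoint edges, i.e. a set of $r$ such $k$-tuples any two of which differ in every coordinate. $\mathcal{K}_r(n_1,\ldots,n_k)$ is the set of all $r$-matchings of $\mathcal{K}(n_1,\ldots,n_k)$. A family $\mathscr{F}\subseteq\mathcal{K}_r(n_1,\ldots,n_k)$ is intersecting if every pair of members of $\mathscr{F}$ share a common edge. A star of $\mathcal{K}_r(n_1,\ldots,n_k)$ is a family of the form $\{M\in\mathcal{K}_r(n_1,\ldots,n_k): e\in M\}$ for some edge $e$ of $\mathcal{K}(n_1,\ldots,n_k)$. *)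

(* Defs.v *)
From mathcomp Require Import all_boot all_order all_algebra.
Set Implicit Arguments.
Unset Strict Implicit.
Unset Printing Implicit Defensive.

(* The part [n_i] is 'I_(n i), so an edge of K(n_1, ..., n_k) is a dependent
   finite function choosing one vertex in each part. *)
Definition edge (k : nat) (n : 'I_k -> nat) : Type :=
  {dffun forall i : 'I_k, 'I_(n i)}.

(* The parts being disjoint, two edges are vertex-disjoint iff they differ in
   every coordinate. *)
Definition vertex_disjoint (k : nat) (n : 'I_k -> nat) (e f : edge n) : bool :=
  [forall i : 'I_k, e i != f i].

Definition matchings (k : nat) (n : 'I_k -> nat) (r : nat) :
    {set {set edge n}} :=
  [set M : {set edge n} | (#|M| == r) &&
     [forall e in M, forall f in M, (e != f) ==> vertex_disjoint e f]].

Definition intersecting (k : nat) (n : 'I_k -> nat)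
    (F : {set {set edge n}}) : Prop :=
  forall M N : {set edge n}, M \in F -> N \in F ->
    exists e : edge n, e \in M /\ e \in N.

Definition star (k : nat) (n : 'I_k -> nat) (r : nat) (e : edge n) :
    {set {set edge n}} :=
  [set M in matchings n r | e \in M].

Definition is_star (k : nat) (n : 'I_k -> nat) (r : nat)
    (F : {set {set edge n}}) : Prop :=
  exists e : edge n, F = star r e.

(* Main.v *)
Require Import Defs.
From mathcomp Require Import all_boot all_order all_algebra.
From mathcomp Require Import all_fingroup zify.
Set Implicit Arguments.
Unset Strict Implicit.
Unset Printing Implicit Defensive.

(* Let [a] be a smallest part and [b] another part. Averaging over the product
   of the symmetric groups, the bound follows from a Katona-type frame indexed
   by the edges: if [r < n a], the edges are arranged on circles on which any
   [r] consecutive edges form a matching; if [r = n a], they are partitioned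
   into perfect matchings of part [a]. Each image of the frame contains at most
   [r] members of the family; if it always contains exactly [r], then every
   image of the partition into "diagonals" (matchings covering part [a]) has a
   diagonal containing a member of the family.
   Fix the components of a diagonal outside part [b]. The permutations of part
   [b] whose diagonal contains a member of the family then form either the
   empty set or an intersecting family of permutations of the largest possible
   size, hence a star by the Cameron-Ku theorem; the centres of all these stars
   coincide and lie in every member of the family.
   The Cameron-Ku theorem comes from Latin squares: each one contains exactly
   one member of a maximum intersecting family of permutations. Switching an
   intercalate shows that the change of the indicator function under a
   transposition of rows [i], [j] depends only on the images of [i] and [j]. *)

(** * Hall's theorem and Latin squares *)

(** Induction on [#|D|]. A tight nonempty proper subset is matched first and its neighbours are
    withheld from the rest; if there is none, any choice for one point preserves Hall's
    condition. *)
Lemma hall (I T : finType) (t0 : T) (N : I -> {set T}) (D : {set I}) :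
    (forall J : {set I}, J \subset D -> #|J| <= #|\bigcup_(i in J) N i|) ->
  exists f : I -> T, {in D &, injective f} /\ {in D, forall i, f i \in N i}.
Proof.
have [m] := ubnP #|D|; elim: m D N => // m IH D N leDm HD.
have [->|[i iD]] := set_0Vmem D.
  by exists (fun=> t0); split=> x; rewrite ?inE // => y; rewrite inE.
have [/existsP[J /and4P[sJD J0 nJD tJ]]|] := boolP [exists J : {set I},
    [&& J \subset D, J != set0, J != D & #|\bigcup_(i in J) N i| <= #|J|]].
- have ltJ : #|J| < #|D| by rewrite proper_card // properEneq nJD.
  have gtJ : 0 < #|J| by rewrite card_gt0.
  have [||f [fi fN]] := IH J N.
  + exact: leq_trans ltJ _.
  + by move=> K sK; apply: HD; apply: subset_trans sJD.
  pose N' x := N x :\: \bigcup_(i in J) N i.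
  have [||g [gi gN]] := IH (D :\: J) N'.
  + rewrite cardsD (setIidPr sJD) (leq_trans _ (leDm : #|D| <= m)) //.
    by rewrite ltn_subrL gtJ (leq_trans gtJ (ltnW ltJ)).
  (* As [J] is tight, the condition for [K] is the one for [K :|: J] with at most [#|J|] removed
     from the right. *)
  + move=> K; rewrite subsetD => /andP[sKD dKJ].
    have := HD (K :|: J); rewrite subUset sKD sJD => /(_ isT).
    rewrite cardsU disjoint_setI0 // cards0 subn0 bigcup_setU => le1.
    have eqN : \bigcup_(i in K) N' i =
        (\bigcup_(i in K) N i :|: \bigcup_(i in J) N i) :\: \bigcup_(i in J) N i.
      rewrite setDUl setDv setU0; apply/setP=> y; apply/bigcupP/setDP.
        by case=> k kK /setDP[yN yJ]; split=> //; apply/bigcupP; exists k.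
      by case=> /bigcupP[k kK yN] yJ; exists k; rewrite // inE yJ.
    rewrite eqN cardsD (setIidPr (subsetUr _ _)) leq_subRL; last first.
      by apply: subset_leq_card; apply: subsetUr.
    by apply: leq_trans le1; rewrite addnC leq_add2l.
  exists (fun x => if x \in J then f x else g x).
  have fJ x : x \in J -> f x \in \bigcup_(i in J) N i.
    by move=> xJ; apply/bigcupP; exists x => //; apply: fN.
  have gJ x : x \in D -> x \notin J -> g x \in N' x.
    by move=> xD xJ; apply: gN; rewrite inE xJ.
  split=> [x y xD yD|x xD].
    case: ifPn => xJ; case: ifPn => yJ e.
    * exact: fi.
    * by have := fJ x xJ; rewrite e; case/setDP: (gJ y yD yJ) => _ /negPf->.
    * by have := fJ y yJ; rewrite -e; case/setDP: (gJ x xD xJ) => _ /negPf->.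
    * by apply: gi; rewrite // inE ?xJ ?yJ.
  case: ifPn => xJ; first exact: fN.
  by case/setDP: (gJ x xD xJ).
rewrite negb_exists => /forallP ntight.
have /card_gt0P[c cN] : 0 < #|N i|.
  have := HD [set i]; rewrite sub1set iD => /(_ isT).
  by rewrite cards1 big_set1.
have [||f [fi fN]] := IH (D :\ i) (fun x => N x :\ c).
- by move: leDm; rewrite (cardsD1 i D) iD add1n ltnS.
- move=> K sK; have [->|K0] := eqVneq K set0; first by rewrite cards0.
  have sKD : K \subset D by apply: subset_trans sK (subsetDl _ _).
  have nKD : K != D by apply: contraTneq iD => <-; apply/negP=> /(subsetP sK); rewrite !inE eqxx.
  have := ntight K; rewrite sKD K0 nKD /= -ltnNge => ltK.
  have -> : \bigcup_(x in K) (N x :\ c) = (\bigcup_(x in K) N x) :\ c.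
    apply/setP=> y; apply/bigcupP/setD1P.
      by case=> k kK /setD1P[yc yN]; split=> //; apply/bigcupP; exists k.
    by case=> yc /bigcupP[k kK yN]; exists k; rewrite // !inE yc.
  move: ltK; rewrite (cardsD1 c (\bigcup_(x in K) N x)).
  by case: (_ \in _); rewrite ?ltnS // => /ltnW.
exists (fun x => if x == i then c else f x).
have fD x : x \in D -> x != i -> f x \in N x :\ c by move=> xD xi; apply: fN; rewrite !inE xi.
split=> [x y xD yD|x xD].
  case: eqP => [->|/eqP xi]; case: eqP => [->|/eqP yi] // e.
  - by have := fD y yD yi; rewrite -e !inE eqxx.
  - by have := fD x xD xi; rewrite e !inE eqxx.
  - by apply: fi; rewrite // !inE ?xi ?yi.
by case: eqP => [->|/eqP xi] //; have /setD1P[] := fD x xD xi.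
Qed.

Lemma hall_perm (T : finType) (N : T -> {set T}) :
    (forall J : {set T}, #|J| <= #|\bigcup_(i in J) N i|) ->
  exists s : {perm T}, forall x, s x \in N x.
Proof.
move=> HN; case: (pickP T) => [t0 _|T0]; last by exists 1%g => x; have := T0 x.
have [J _|f [fi fN]] := @hall _ _ t0 N setT; first exact: HN.
have fi' : injective f by move=> x y; apply: fi; rewrite inE.
by exists (perm fi') => x; rewrite permE fN // inE.
Qed.

(** Off [A] the values come from [s @: (~: A)]. A point loses at most [size ts] of them, which
    settles Hall's condition for small sets; a value is forbidden at no more than [size ts] points,
    so a larger set reaches every value. *)
Lemma perm_avoid (T : finType) (s : {perm T}) (A : {set T}) (ts : seq {perm T}) :
    2 * size ts <= #|~: A| ->
  exists2 u : {perm T}, {in A, u =1 s} &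
    forall x, x \notin A -> forall t, t \in ts -> u x != t x.
Proof.
move=> szA.
pose B := s @: (~: A).
pose N x := if x \in A then [set s x] else B :\: [set c | c \in [seq t x | t : {perm T} <- ts]].
have cB : #|B| = #|~: A| by rewrite card_imset //; apply: perm_inj.
have [J|u uN] := @hall_perm T N.
  have NA : \bigcup_(x in J :&: A) N x = s @: (J :&: A).
    apply/setP=> c; apply/bigcupP/imsetP => -[x xJ cx]; exists x => //.
      by move: cx; rewrite /N; case/setIP: xJ => _ ->; rewrite inE => /eqP.
    by rewrite /N; case/setIP: xJ => _ ->; rewrite inE cx.
  have NB : #|J :\: A| <= #|\bigcup_(x in J :\: A) N x|.
    have [->|[x0 x0J]] := set_0Vmem (J :\: A); first by rewrite cards0.
    have [le|gt] := leqP #|J :\: A| (#|B| - size ts).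
      apply: leq_trans le _; apply: leq_trans (subset_leq_card (bigcup_sup x0 x0J)).
      rewrite /N; have /setDP[_ /negPf->] := x0J.
      rewrite cardsD leq_sub2l // (leq_trans (subset_leq_card (subsetIr _ _))) //.
      rewrite -(size_map (fun t : {perm T} => t x0)) cardsE; exact: card_size.
    apply: (@leq_trans #|B|).
      by rewrite cB subset_leq_card // setDE subsetIr.
    apply: subset_leq_card; apply/subsetP => c cIn; apply/negPn/negP => cNot.
    have sub : {subset J :\: A <= [seq (t^-1)%g c | t : {perm T} <- ts]}.
      move=> x xJ; have /setDP[xJ' xA] := xJ.
      have : c \notin N x by apply: contra cNot => cN; apply/bigcupP; exists x.
      rewrite /N (negPf xA) !inE cIn andbT negbK => /mapP[t tts ->].
      by apply/mapP; exists t; rewrite ?permK.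
    have := leq_trans (subset_leq_card (introT subsetP sub)) (card_size _).
    rewrite size_map => le2.
    have := leq_trans gt le2; rewrite ltn_subLR; last by rewrite cB (leq_trans _ szA) // leq_pmull.
    by rewrite addnn -mul2n cB ltnNge szA.
  have eJ : \bigcup_(x in J) N x = \bigcup_(x in J :&: A) N x :|: \bigcup_(x in J :\: A) N x.
    by rewrite -bigcup_setU setID.
  suff dj : [disjoint \bigcup_(x in J :&: A) N x & \bigcup_(x in J :\: A) N x].
    rewrite eJ cardsU (disjoint_setI0 dj) cards0 subn0.
    rewrite -(cardsID A J) NA card_imset ?leq_add2l //; exact: perm_inj.
  rewrite NA -setI_eq0; apply/eqP/setP => c; rewrite !inE.
  apply/negP => /andP[/imsetP[x /setIP[_ xA] ->] /bigcupP[y /setDP[_ yA]]].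
  rewrite /N (negPf yA) => /setDP[/imsetP[z zA /perm_inj ez] _].
  by move: zA; rewrite -ez inE xA.
exists u => [x xA|x xA t tts].
  by have := uN x; rewrite /N xA inE => /eqP.
have := uN x; rewrite /N (negPf xA) !inE => /andP[/mapP nt _].
by apply/eqP => e; apply: nt; exists t.
Qed.

(** Pairwise [disj] permutations are the rows of a Latin rectangle, and [#|T|] of them form a Latin
    square. *)
Definition disj (T : finType) (s t : {perm T}) := [forall x, s x != t x].

(** The graph joining each point to the values still missing there is regular of degree
    [#|T| - size ts]; counting its edges gives Hall's condition. *)
Lemma latin_extend1 (T : finType) (ts : seq {perm T}) :
    pairwise (@disj T) ts -> size ts < #|T| ->
  exists u, all (@disj T u) ts.
Proof.
move=> pw lt; pose N x := [set c | all (fun t : {perm T} => t x != c) ts].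
(* Used for the values missing at a point and, through inverses, for the points at which a value is
   missing. *)
have cardC (A : {set T}) (g : {perm T} -> T) :
    pairwise (fun t t' => g t != g t') ts -> (forall c, (c \in A) = all (fun t => g t != c) ts) ->
    #|A| = #|T| - size ts.
  move=> pwg eA; rewrite -(size_map g).
  have ug : uniq (map g ts).
    by rewrite uniq_pairwise pairwise_map; apply: sub_pairwise pwg.
  rewrite -(card_uniqP ug) -[#|T|](cardC (mem (map g ts))) addKn.
  apply: eq_card => c; rewrite eA !inE.
  by elim: ts {pw lt pwg eA ug N} => //= t ts' ->; rewrite inE eq_sym negb_or.
have cN x : #|N x| = #|T| - size ts.
  apply: (cardC _ (fun t => t x)); last by move=> c; rewrite inE.
  by apply: sub_pairwise pw => t t' /forallP.
have cN' c : #|[set x | c \in N x]| = #|T| - size ts.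
  apply: (cardC _ (fun t => (t^-1)%g c)).
    apply: sub_pairwise pw => t t' /forallP d.
    by apply/eqP => e; have := d (t^-1%g c); rewrite permKV e permKV eqxx.
  move=> x; rewrite !inE; apply: eq_all => t.
  by congr (~~ _); apply/eqP/eqP => <-; rewrite ?permK ?permKV.
have gt0 : 0 < #|T| - size ts by rewrite subn_gt0.
have [J|u uN] := @hall_perm T N; last first.
  exists u; apply/allP => t tts; apply/forallP => x.
  by have := uN x; rewrite inE => /allP/(_ t tts); rewrite eq_sym.
rewrite -(leq_pmul2r gt0).
have -> : #|J| * (#|T| - size ts) = \sum_(x in J) \sum_(c in \bigcup_(x in J) N x) (c \in N x).
  rewrite -sum_nat_const; apply: eq_bigr => x xJ.
  rewrite -(cN x) -sum1_card big_mkcond /= [RHS]big_mkcond /=.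
  apply: eq_bigr => c _; case cx: (c \in N x); rewrite ?if_same //.
  by have -> : c \in \bigcup_(x in J) N x by apply/bigcupP; exists x.
rewrite exchange_big /= -sum_nat_const; apply: leq_sum => c _.
rewrite -(cN' c) -sum1_card big_mkcond /= [X in _ <= X]big_mkcond /=.
by apply: leq_sum => x _; rewrite inE; case: (x \in J) (c \in N x) => [] [].
Qed.

Lemma latin_extend (T : finType) (ts : seq {perm T}) :
    pairwise (@disj T) ts -> size ts <= #|T| ->
  exists us, pairwise (@disj T) (us ++ ts) /\ size (us ++ ts) = #|T|.
Proof.
move=> pw; elim: {ts}_.+1 {-2}ts (ltnSn (#|T| - size ts)) pw => // m IH ts ltm pw.
rewrite leq_eqVlt => /predU1P[e|lt]; first by exists [::].
have [u au] := latin_extend1 pw lt.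
have [||//=|us [pus sus]] := IH (u :: ts).
- by rewrite /= subnS prednK ?subn_gt0 //; move: ltm; rewrite ltnS.
- by rewrite /= au.
by exists (rcons us u); rewrite cat_rcons.
Qed.

(** * Intersecting families of permutations *)

Lemma disj_mulr (T : finType) (s t u : {perm T}) : disj (s * u) (t * u) = disj s t.
Proof. by apply: eq_forallb => x; rewrite !permM (inj_eq perm_inj). Qed.

Lemma perm_eq_off1 (T : finType) (s t : {perm T}) y :
  (forall x, x != y -> s x = t x) -> s = t.
Proof.
move=> H; apply/permP => x; have [->|/H//] := eqVneq x y.
have [e|ne] := eqVneq ((t^-1)%g (s y)) y; first by rewrite -{2}e permKV.
by have := H _ ne; rewrite permKV => /perm_inj e; rewrite e eqxx in ne.
Qed.

Lemma perm_eq_off2 (T : finType) (s t : {perm T}) l m :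
  (forall x, x != l -> x != m -> s x = t x) -> t = s \/ t = (tperm l m * s)%g.
Proof.
move=> H; have [e|nl] := eqVneq (s l) (t l).
  left; apply/esym; apply: (@perm_eq_off1 _ _ _ m) => x xm.
  by have [->|xl] := eqVneq x l; rewrite // H.
right; apply/esym/(@perm_eq_off1 _ _ _ m) => x xm; rewrite permM.
have [->|xl] := eqVneq x l; last by rewrite tpermD 1?eq_sym // H.
rewrite tpermL; pose z := (s^-1)%g (t l).
have ez : s z = t l by rewrite permKV.
have [zl|zl] := eqVneq z l; first by rewrite -ez zl eqxx in nl.
have [<-//|zm] := eqVneq z m.
by have := H z zl zm; rewrite ez => /perm_inj e; rewrite e eqxx in zl.
Qed.

Lemma card_perms (T : finType) : #|{perm T}| = #|T|`!.
Proof.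
by rewrite -cardsT -card_perm; apply: eq_card => s; rewrite !inE; apply/esym/subsetP.
Qed.

Section Intersecting.
Variables (T : finType) (F : {set {perm T}}).
Hypothesis intF : {in F &, forall s t : {perm T}, exists x, s x = t x}.

Lemma count_latin_le1 (L : seq {perm T}) :
  pairwise (@disj T) L -> count (mem F) L <= 1.
Proof.
move=> pw; rewrite -size_filter.
have := pairwise_filter (mem F) pw; have := filter_all (mem F) L.
case: (filter _ _) => [|a [|b l]] // /and3P[aF bF _] /andP[/andP[/forallP dab _] _].
by have [x e] := intF aF bF; have := dab x; rewrite e eqxx.
Qed.

Lemma sum_count_translate (L : seq {perm T}) :
  \sum_(g : {perm T}) count (mem F) [seq t * g | t <- L]%g = size L * #|F|.
Proof.
under eq_bigr do rewrite count_map -sum1_count big_mkcond /=.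
rewrite exchange_big /= -sum1_size big_distrl /=; apply: eq_bigr => t _.
rewrite mul1n -sum1_card [RHS]big_mkcond /= [RHS](reindex_inj (mulgI t)) /=.
by apply: eq_bigr.
Qed.

Lemma pairwise_translate (L : seq {perm T}) g :
  pairwise (@disj T) L -> pairwise (@disj T) [seq t * g | t <- L]%g.
Proof.
by move=> pw; rewrite pairwise_map; apply: sub_pairwise pw => s t; rewrite /= disj_mulr.
Qed.

(** Right translates of a Latin square are Latin squares, each with at most one member of [F];
    averaging over all translates gives the bound. *)
Lemma perm_bound : 0 < #|T| -> #|F| <= (#|T|.-1)`!.
Proof.
move=> T0; have [us []] := @latin_extend T [::] isT isT; rewrite cats0 => pw sz.
have : size us * #|F| <= \sum_(g : {perm T}) 1.
  by rewrite -sum_count_translate leq_sum // => g _; apply/count_latin_le1/pairwise_translate.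
rewrite sum1_card sz card_perms.
by rewrite -{2}(prednK T0) factS prednK // leq_pmul2l.
Qed.

Hypothesis bigF : (#|T|.-1)`! <= #|F|.

(** Equality in the averaging bound leaves no translate of [L] without a member of [F], in
    particular not [L] itself. *)
Lemma count_latin (L : seq {perm T}) : 
  0 < #|T| -> pairwise (@disj T) L -> size L = #|T| -> count (mem F) L = 1.
Proof.
move=> T0 pw sz; have := sum_count_translate L.
have le g : count (mem F) [seq t * g | t <- L]%g <= 1.
  exact/count_latin_le1/pairwise_translate.
rewrite sz => eS.
apply/eqP; rewrite eqn_leq count_latin_le1 //=.
rewrite -[L]map_id -(eq_map (mulg1)) lt0n; apply/eqP => c0.
have : \sum_(g : {perm T}) count (mem F) [seq t * g | t <- L]%g < \sum_(g : {perm T}) 1.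
  rewrite (bigD1 1%g) //= [X in _ < X](bigD1 1%g) //= c0 add0n add1n ltnS.
  by apply: leq_sum.
rewrite eS sum1_card card_perms.
by rewrite -{2}(prednK T0) factS prednK // ltn_pmul2l // ltnNge bigF.
Qed.

Let f (s : {perm T}) : nat := s \in F.

(** The rows [s] and [t] have an intercalate at [i] and [j]. Completing them to a Latin square and
    switching it gives a second square with the same other rows; both contain exactly one member of
    [F]. *)
Lemma switch s t i j : disj s t -> t i = s j -> t j = s i ->
  f s + f t = f (tperm i j * s)%g + f (tperm i j * t)%g.
Proof.
move=> dst ti tj.
have T0 : 0 < #|T| by apply/card_gt0P; exists i.
have T1 : 1 < #|T|.
  have ij : i != j by apply/eqP => e; move/forallP/(_ i): dst; rewrite ti -e eqxx.
  by apply/card_gt1P; exists i, j.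
have [|//|us [pw sz]] := @latin_extend T [:: s; t]; first by rewrite /= dst.
have H1 := count_latin T0 pw sz.
have pw2 : pairwise (@disj T) (us ++ [:: tperm i j * s; tperm i j * t]%g).
  move: pw; rewrite !pairwise_cat => /and3P[ar pu _]; apply/and3P; split=> //=.
  - apply/allrelP => u v uu; have h w : w \in [:: s; t] -> disj u w by move/allrelP: ar; apply.
    have us1 x : u x != s x by move/forallP: (h s (mem_head _ _)).
    have ut x : u x != t x by have /forallP := h t (mem_last s [:: t]).
    rewrite !inE => /pred2P[]->; apply/forallP => x; rewrite permM; case: tpermP => [->|->|_ _] //; 
     by rewrite ?ti ?tj // -?ti -?tj.
  - rewrite !andbT; apply/forallP => x; rewrite !permM; exact: (forallP dst).
have H2 : count (mem F) (us ++ [:: tperm i j * s; tperm i j * t]%g) = 1.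
  by apply: count_latin; rewrite // -sz !size_cat.
by move: H1 H2; rewrite !count_cat /= !addn0 /f => <- /addnI->.
Qed.

(** The intercalate lies in the disjoint rows [s1] and [tperm i j * s2]; switching it produces
    [tperm i j * s1] and [s2]. *)
Lemma switch_const_disj (s1 s2 : {perm T}) i j : i != j -> s1 i = s2 i -> s1 j = s2 j ->
    (forall x, x != i -> x != j -> s1 x != s2 x) ->
  f s1 + f (tperm i j * s2)%g = f (tperm i j * s1)%g + f s2.
Proof.
move=> ij e1 e2 d.
rewrite (@switch _ (tperm i j * s2)%g i j) ?permM ?tpermL ?tpermR //.
  by rewrite mulgA tperm2 mul1g.
apply/forallP => x; rewrite permM; case: tpermP => [->|->|/eqP xi /eqP xj]; last exact: d.
  by rewrite -e2 (inj_eq perm_inj).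
by rewrite -e1 (inj_eq perm_inj) eq_sym.
Qed.

Lemma card_setC2 (i j : T) : i != j -> #|~: [set i; j]| = #|T| - 2.
Proof. by move=> ij; rewrite cardsCs setCK cards2 ij. Qed.

Section Five.
Variables (i j l m c : T) (s : {perm T}).
Let e := [:: i; j; l; m; c].
Hypotheses (ue : uniq e) (cT : #|T| = 5).

(** A word over 0, ..., 4 encodes a permutation of the five points of [e] by the indices of the
    images, so that Latin squares can be checked by computation. *)
Let word_fun (w : seq nat) x := nth i e (nth 0 w (index x e)).
Let word_perm (w : seq nat) : {perm T} :=
  odflt 1%g [pick p : {perm T} | [forall x, p x == word_fun w x]].

Let in_e x : x \in e.
Proof.
have : [set y in e] = setT.
  by apply/eqP; rewrite eqEcard subsetT cardsT cT cardsE (card_uniqP ue).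
by move/setP/(_ x); rewrite !inE.
Qed.

Let word_permE w x : perm_eq w (iota 0 5) -> word_perm w x = word_fun w x.
Proof.
move=> pw; rewrite /word_perm; case: pickP => [p /forallP/(_ x)/eqP //|no].
have uw : uniq w by rewrite (perm_uniq pw) iota_uniq.
have szw : size w = 5 by rewrite (perm_size pw).
have ltw k : k < 5 -> nth 0 w k < 5.
  move=> k5; have : nth 0 w k \in iota 0 5 by rewrite -(perm_mem pw) mem_nth ?szw.
  by rewrite mem_iota.
have lti y : index y e < 5 by rewrite -[5]/(size e) index_mem.
have inj : injective (word_fun w).
  move=> y z /eqP; rewrite /word_fun nth_uniq ?ltw // nth_uniq ?szw //.
  by move/eqP/(congr1 (nth i e)); rewrite !nth_index.
by have := no (perm inj); case/forallP => y; rewrite permE.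
Qed.

Let word_permP w (u : {perm T}) : perm_eq w (iota 0 5) -> 
  [seq u x | x <- e] = [seq nth i e k | k <- w] -> word_perm w = u.
Proof.
move=> pw eu; apply/permP => x; rewrite word_permE //.
have lti : index x e < 5 by rewrite -[5]/(size e) index_mem.
have szw : size w = 5 by rewrite (perm_size pw).
by rewrite /word_fun -(nth_map _ i (nth i e)) ?szw // -eu (nth_map i) // nth_index.
Qed.

Let words_latin (ws : seq (seq nat)) : size ws = 5 -> 
    all (fun w => perm_eq w (iota 0 5)) ws ->
    pairwise (fun w v => all (fun k => nth 0 w k != nth 0 v k) (iota 0 5)) ws ->
  count (mem F) [seq word_perm w * s | w <- ws]%g = 1.
Proof.
move=> sz aw pw; apply: count_latin; rewrite ?cT // ?size_map //.
have -> : [seq word_perm w * s | w <- ws]%g =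
    [seq u * s | u : {perm T} <- [seq word_perm w | w <- ws]]%g.
  by rewrite -map_comp.
apply: pairwise_translate; rewrite pairwise_map.
apply: (sub_in_pairwise (P := [pred w | perm_eq w (iota 0 5)])) pw; last exact: aw.
move=> w v; rewrite !inE => pw pv /allP d; apply/forallP => x; rewrite !word_permE //.
have lti : index x e < 5 by rewrite -[5]/(size e) index_mem.
have lt5 z k : perm_eq z (iota 0 5) -> k < 5 -> nth 0 z k < 5.
  move=> pz k5; have : nth 0 z k \in iota 0 5 by rewrite -(perm_mem pz) mem_nth // (perm_size pz).
  by rewrite mem_iota.
by rewrite nth_uniq ?lt5 // d // mem_iota.
Qed.

(* Apart from one permutation each, the four Latin squares below are X+U, Y+V,
   X+V and Y+U for pairs X, Y, U, V of permutations, so that an alternating sum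
   leaves the four permutations of the statement. For [#|T| = 5] this replaces
   the argument of [switch_const], in which [perm_avoid] needs [4 <= #|T| - 2]. *)
Lemma second_difference5 :
  f s + f (tperm i j * (tperm l m * s))%g = f (tperm i j * s)%g + f (tperm l m * s)%g.
Proof.
have := @words_latin [:: [:: 0;2;1;4;3]; [:: 1;0;2;3;4]; [:: 2;4;3;1;0];
  [:: 3;1;4;0;2]; [:: 4;3;0;2;1]] erefl erefl erefl.
have := @words_latin [:: [:: 0;1;3;2;4]; [:: 1;2;4;0;3]; [:: 2;4;0;3;1];
  [:: 3;0;1;4;2]; [:: 4;3;2;1;0]] erefl erefl erefl.
have := @words_latin [:: [:: 0;2;1;4;3]; [:: 1;0;3;2;4]; [:: 2;4;0;3;1];
  [:: 3;1;4;0;2]; [:: 4;3;2;1;0]] erefl erefl erefl.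
have := @words_latin [:: [:: 0;1;2;3;4]; [:: 1;2;4;0;3]; [:: 2;4;3;1;0];
  [:: 3;0;1;4;2]; [:: 4;3;0;2;1]] erefl erefl erefl.
have := ue; rewrite /= !inE !negb_or !andbT => 
  /and4P[/and4P[ij il im ic] /and3P[jl jm jc] /andP[lm lc] mc].
(* Only these four words are evaluated; each of the others occurs in two of the squares and
   cancels. *)
have -> : word_perm [:: 0;1;2;3;4] = 1%g by apply: word_permP; rewrite //= !perm1.
have -> : word_perm [:: 1;0;2;3;4] = tperm i j.
  by apply: word_permP; rewrite //= tpermL tpermR !tpermD.
have -> : word_perm [:: 0;1;3;2;4] = tperm l m.
  by apply: word_permP; rewrite //= tpermL tpermR !tpermD // eq_sym.
have -> : word_perm [:: 1;0;3;2;4] = (tperm i j * tperm l m)%g.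
  apply: word_permP; rewrite //= !permM tpermL tpermR !(tpermD (x := i)) // tpermL tpermR.
  by rewrite !tpermD // eq_sym.
rewrite /= mul1g -!mulgA /f; do ![move: (nat_of_bool _) => ?]; clear; lia.
Qed.
End Five.

(** From six points on, [s1] and [s2] are compared through a third permutation that agrees with them
    at [i] and [j] and is disjoint from both elsewhere. *)
Lemma switch_const (s1 s2 : {perm T}) i j : 4 <= #|T| -> i != j -> 
    s1 i = s2 i -> s1 j = s2 j ->
  f s1 + f (tperm i j * s2)%g = f (tperm i j * s1)%g + f s2.
Proof.
move=> T4 ij ei ej; have cA := card_setC2 ij.
have [T6|T6] := leqP 6 #|T|.
  have [|u uA uB] := @perm_avoid _ s1 [set i; j] [:: s1; s2].
    by rewrite cA leq_subRL // (leq_trans _ T6).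
  have [ui uj] : u i = s1 i /\ u j = s1 j by rewrite !uA // !inE eqxx ?orbT.
  have uO x t : x != i -> x != j -> t \in [:: s1; s2] -> t x != u x.
    by move=> xi xj ht; rewrite eq_sym uB // !inE negb_or xi.
  have := @switch_const_disj s1 u i j ij; have := @switch_const_disj s2 u i j ij.
  rewrite ui uj -ei -ej => /(_ erefl erefl) H2 /(_ erefl erefl) H1.
  have {}H2 := H2 (fun x xi xj => uO x s2 xi xj (mem_last s1 [:: s2])).
  have {}H1 := H1 (fun x xi xj => uO x s1 xi xj (mem_head _ _)).
  lia.
(* Now [#|T|] is 4 or 5. If [s1] and [s2] also agree at a third point [c], at most two points
   remain, so they are equal or differ by a transposition of these two. *)
have [/forallP d|] := boolP [forall x, (x \notin [set i; j]) ==> (s1 x != s2 x)].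
  apply: switch_const_disj => // x xi xj.
  by have := d x; rewrite !inE negb_or xi xj.
rewrite negb_forall => /existsP[c]; rewrite negb_imply negbK => /andP[cA' /eqP ec].
have [ci cj] : c != i /\ c != j by move: cA'; rewrite !inE negb_or => /andP.
have : #|~: [set i; j] :\ c| <= 2.
  have := cardsD1 c (~: [set i; j]); rewrite inE cA' cA; lia.
have same : s1 = s2 -> f s1 + f (tperm i j * s2)%g = f (tperm i j * s1)%g + f s2.
  by move=> ->; rewrite addnC.
have [no|[l]] := set_0Vmem (~: [set i; j] :\ c) => [_|+ le2].
  apply/same/permP => x; have := in_set0 x; rewrite -no !inE /=.
  by have [->//|_] := eqVneq x c; have [->//|_] := eqVneq x i; have [->|] := eqVneq x j.
rewrite !inE negb_or => /and3P[lc li lj].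
have [no|[m]] := set_0Vmem (~: [set i; j] :\ c :\ l).
  apply/same/(@perm_eq_off1 _ _ _ l) => x xl; have := in_set0 x; rewrite -no !inE xl /=.
  by have [->//|_] := eqVneq x c; have [->//|_] := eqVneq x i; have [->|] := eqVneq x j.
rewrite !inE negb_or => /and4P[ml mc mi mj].
have off2 x : x != l -> x != m -> s1 x = s2 x.
  move=> xl xm; have [->//|xc] := eqVneq x c; have [->//|xi] := eqVneq x i.
  have [->//|xj] := eqVneq x j.
  suff : 2 < #|~: [set i; j] :\ c| by rewrite ltnNge le2.
  apply/card_gt2P; exists l, m, x; rewrite !inE !negb_or lc li lj mc mi mj xc xi xj.
  by rewrite (eq_sym l) ml (eq_sym m) xm xl.
have [/esym/same//|->] := perm_eq_off2 off2.
have ue : uniq [:: i; j; l; m; c].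
  rewrite /= !inE !negb_or ij mc.
  by rewrite !(eq_sym i) !(eq_sym j) !(eq_sym l m) li mi ci lj mj cj ml lc.
apply: (second_difference5 s1 ue); apply/eqP; rewrite eqn_leq -ltnS T6 /=.
have /card_uniqP /= <- := ue; exact: max_card.
Qed.

(* The cells [c] and [d] form a strong pair when switching them away from some
   member of [F] leaves [F]; by [switch_const] every permutation through both
   cells is then in [F]. *)
Definition strong (c d : T * T) := [exists s : {perm T},
  [&& s c.1 == c.2, s d.1 == d.2, c.1 != d.1, s \in F & (tperm c.1 d.1 * s)%g \notin F]].

Lemma strong_sym c d : strong c d = strong d c.
Proof.
apply: eq_existsb => s; rewrite tpermC [d.1 == _]eq_sym.
by rewrite !andbA [(s c.1 == _) && _]andbC.
Qed.

Lemma strong_neq c d : strong c d -> c.1 != d.1 /\ c.2 != d.2.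
Proof.
case/existsP=> s /and5P[/eqP<- /eqP<- cd _ _].
by rewrite (inj_eq perm_inj).
Qed.

Lemma strong_mem c d (s : {perm T}) : 4 <= #|T| -> strong c d -> 
  s c.1 = c.2 -> s d.1 = d.2 -> s \in F.
Proof.
move=> T4 /existsP[t /and5P[/eqP tc /eqP td cd tF tF']] sc sd.
have := @switch_const s t _ _ T4 cd; rewrite sc sd tc td => /(_ erefl erefl).
by rewrite /f tF (negPf tF'); case: (s \in F) => //=; case: (_ \in F).
Qed.

(** Otherwise a permutation through both cells that avoids [s] elsewhere would be a member of [F]
    disjoint from [s]. *)
Lemma strong_meet c d (s : {perm T}) : 4 <= #|T| -> strong c d -> 
  s \in F -> (s c.1 == c.2) || (s d.1 == d.2).
Proof.
move=> T4 cd sF; have /existsP[t /and5P[/eqP tc /eqP td ncd tF tF']] := cd.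
have [|u uA uB] := @perm_avoid _ t [set c.1; d.1] [:: s].
  by rewrite card_setC2 // leq_subRL // (leq_trans _ T4).
have [uc ud] : u c.1 = c.2 /\ u d.1 = d.2 by rewrite !uA // !inE eqxx ?orbT.
have [x ex] := intF sF (strong_mem T4 cd uc ud).
have [|xA] := boolP (x \in [set c.1; d.1]).
  by rewrite !inE => /pred2P[] xe; rewrite -xe ex xe ?uc ?ud eqxx ?orbT.
by have := uB x xA s (mem_head _ _); rewrite ex eqxx.
Qed.

(** Take [u] through [c] and [d], avoiding elsewhere a permutation through [c'] and [d']. Being in
    [F], it passes through [c'] or [d'], which can only happen at [c] or [d]. *)
Lemma strong_intersect c d c' d' : 4 <= #|T| -> strong c d -> strong c' d' ->
  [|| c == c', c == d', d == c' | d == d'].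
Proof.
move=> T4 cd cd'; have /existsP[t /and5P[/eqP tc /eqP td ncd tF tF']] := cd.
have /existsP[t' /and5P[/eqP tc' /eqP td' _ _ _]] := cd'.
have [|u uA uB] := @perm_avoid _ t [set c.1; d.1] [:: t'].
  by rewrite card_setC2 // leq_subRL // (leq_trans _ T4).
have [uc ud] : u c.1 = c.2 /\ u d.1 = d.2 by rewrite !uA // !inE eqxx ?orbT.
have mem_cell e : t' e.1 = e.2 -> u e.1 = e.2 -> (c == e) || (d == e).
  move=> te ue; have [|eA] := boolP (e.1 \in [set c.1; d.1]).
    rewrite !inE => /pred2P[] ee; rewrite -!pair_eqE /pair_eq /= ee eqxx /=.
      by rewrite -ue ee uc eqxx.
    by rewrite -ue ee ud eqxx orbT.
  by have := uB _ eA t' (mem_head _ _); rewrite ue te eqxx.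
have /orP[/eqP uc'|/eqP ud'] := strong_meet T4 cd' (strong_mem T4 cd uc ud).
  by have /orP[->|->] := mem_cell _ tc' uc'; rewrite ?orbT.
by have /orP[->|->] := mem_cell _ td' ud'; rewrite ?orbT.
Qed.

(** Transpositions turn [t] into [s], each creating a new agreement and keeping the old ones. The
    step that first enters [F] exhibits a strong pair away from all points where [t] and [s]
    agree. *)
Lemma exists_strong (s t : {perm T}) : s \in F -> t \notin F ->
  exists x y (u : {perm T}), strong (x, u x) (y, u y) /\
    forall z, t z = s z -> [/\ u z = s z, z != x & z != y].
Proof.
move=> sF; have [m] := ubnP #|[set z | t z != s z]|.
elim: m t => // m IH t ltm tF.
have [x tx] : exists x, t x != s x.
  have [x|e] := pickP (fun x => t x != s x); first by exists x.
  by rewrite (_ : t = s) ?sF // in tF; apply/permP => x; apply/eqP; rewrite -[_ == _]negbK e.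
pose y := (t^-1 (s x))%g; have ty : t y = s x by rewrite permKV.
have yx : y != x by apply: contraNneq tx => e; rewrite -{1}e ty.
have sy : t y != s y by rewrite ty (inj_eq perm_inj) eq_sym.
pose u := (tperm x y * t)%g.
have uz z : t z = s z -> [/\ u z = s z, z != x & z != y].
  move=> ez; have zx : z != x by apply: contraNneq tx => <-; rewrite ez.
  have zy : z != y by apply: contraNneq sy => <-; rewrite ez.
  by split=> //; rewrite permM tpermD // eq_sym.
have [uF|uF] := boolP (u \in F).
  exists x, y, u; split=> //; apply/existsP; exists u.
  by rewrite /= !eqxx eq_sym yx uF /u mulgA tperm2 mul1g.
have [|x' [y' [v [sv vz]]]] := IH u _ uF; last first.
  by exists x', y', v; split=> // z /uz[/vz].
rewrite -ltnS; apply: leq_trans ltm; rewrite ltnS; apply: proper_card.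
apply/properP; split.
  by apply/subsetP => z; rewrite !inE; apply: contraNneq => /uz[->].
by exists x; rewrite !inE // permM tpermL ty eqxx.
Qed.

(** Strong pairs are edges of a graph on the cells, any two of which meet, so they form a star or a
    triangle; the triangle is excluded. *)
Lemma strong_common : 4 <= #|T| -> F != set0 ->
  exists c, forall a b, strong a b -> (a == c) || (b == c).
Proof.
move=> T4 F0.
have [/existsP[e /existsP[d ed]]|no] := boolP [exists c, exists d, strong c d]; last first.
  have [i _] : exists i : T, true by have /card_gt0P[i] := leq_trans (isT : 0 < 4) T4; exists i.
  exists (i, i) => a b ab; case/negP: no; apply/existsP; exists a; by apply/existsP; exists b.
have [/forallP he|] := boolP [forall a, forall b, strong a b ==> ((a == e) || (b == e))].
  by exists e => a b ab; have /forallP/(_ b)/implyP := he a; apply.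
have [/forallP hd|] := boolP [forall a, forall b, strong a b ==> ((a == d) || (b == d))].
  by exists d => a b ab; have /forallP/(_ b)/implyP := hd a; apply.
have third x y : strong x y -> ~~ [forall a, forall b, strong a b ==> ((a == x) || (b == x))] ->
    exists2 g, strong y g & g != x.
  move=> xy /forallPn[a /forallPn[b]]; rewrite negb_imply negb_or => /and3P[ab ax bx].
  have := strong_intersect T4 xy ab; rewrite ![x == _]eq_sym (negPf ax) (negPf bx) /=.
  by case/orP => /eqP ->; [exists b|exists a; rewrite // strong_sym].
move=> nd ne.
have [g dg ge] := third _ _ ed ne.
have := ed; rewrite strong_sym => /third/(_ nd)[h eh hd].
have [de1 de2] := strong_neq ed.
have ghE : g = h.
  have := strong_intersect T4 dg eh; rewrite (negPf ge) ![d == _]eq_sym (negPf hd).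
  by case/or4P => // [|/eqP//]; move=> /eqP de; rewrite de eqxx in de1.
rewrite -{h hd}ghE in eh.
have [eg1 eg2] := strong_neq eh; have [dg1 dg2] := strong_neq dg.
have /existsP[s /and5P[/eqP se /eqP sd _ sF _]] := ed.
have /existsP[t /and5P[_ /eqP tg _ _ _]] := dg.
(* In a triangle [e], [d], [g], take [u] in [F] through [e] and [d] but not [g]. Switching [e.1] and
   [g.1] misses both [e] and [g], hence leaves [F]; so [e] and the cell of [u] at [g.1] form a
   strong pair, which does not meet the pair of [d] and [g]. *)
have [|u uA uB] := @perm_avoid _ s [set e.1; d.1] [:: t].
  by rewrite card_setC2 // leq_subRL // (leq_trans _ T4).
have [ue ud] : u e.1 = e.2 /\ u d.1 = d.2 by rewrite !uA // !inE eqxx ?orbT.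
have ug : u g.1 != g.2.
  by rewrite -tg; apply: uB (mem_head _ _); rewrite !inE negb_or ![g.1 == _]eq_sym eg1.
have u'F : (tperm e.1 g.1 * u)%g \notin F.
  apply/negP => /(strong_meet T4 eh).
  rewrite !permM tpermL tpermR ue (negPf eg2) orbF -ue (inj_eq perm_inj).
  by rewrite eq_sym (negPf eg1).
have eg' : strong e (g.1, u g.1).
  by apply/existsP; exists u; rewrite /= ue !eqxx eg1 u'F (strong_mem T4 ed).
have := strong_intersect T4 eg' dg.
have ne1 (a b : T * T) : a.1 != b.1 -> (a == b) = false by move=> ab; apply: contraNF ab => /eqP->.
have ne2 (a b : T * T) : a.2 != b.2 -> (a == b) = false by move=> ab; apply: contraNF ab => /eqP->.
rewrite (ne1 e d) // (ne1 e g) // (ne1 (g.1, u g.1) d) /= ?[g.1 == _]eq_sym //.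
by rewrite (ne2 (g.1, u g.1) g).
Qed.

End Intersecting.

(** The Cameron-Ku theorem: the centre of the star is the cell common to all strong pairs. Up to
    three points, [F] has at most two members. *)
Theorem perm_star (T : finType) (F : {set {perm T}}) :
    {in F &, forall s t : {perm T}, exists x, s x = t x} ->
    (#|T|.-1)`! <= #|F| -> 0 < #|T| ->
  exists i p, F = [set s : {perm T} | s i == p].
Proof.
move=> intF bigF T0.
have /set0Pn[s0 s0F] : F != set0 by rewrite -card_gt0 (leq_trans (fact_gt0 _) bigF).
have [T4|T3] := leqP 4 #|T|; last first.
  suff [i iP] : exists i, {in F, forall t : {perm T}, t i = s0 i}.
    exists i, (s0 i); apply/eqP; rewrite eqEcard; apply/andP; split.
      by apply/subsetP => t /iP; rewrite inE => ->.
    apply: leq_trans bigF; apply: perm_bound => // s t; rewrite !inE => /eqP si /eqP ti.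
    by exists i; rewrite si ti.
  have [/existsP[t /andP[tF ts]]|no] := boolP [exists t in F, t != s0]; last first.
    have /card_gt0P[i _] := T0; exists i => t tF.
    by move: no; rewrite negb_exists => /forallP/(_ t); rewrite tF negbK => /eqP->.
  have [i ei] := intF _ _ tF s0F; exists i => u uF.
  have [->//|us] := eqVneq u s0; have [->//|ut] := eqVneq u t.
  have : 2 < #|F| by apply/card_gt2P; exists s0, t, u; rewrite // eq_sym ts eq_sym ut us.
  rewrite ltnNge (leq_trans (perm_bound intF T0)) //.
  by case: #|T| T0 T3 => [|[|[|[|]]]].
have F0 : F != set0 by apply/set0Pn; exists s0.
have [c cP] := strong_common intF bigF T4 F0.
(* A permutation disjoint from [s0] lies outside [F], so a strong pair exists; its witness passes
   through both cells, one of which is [c]. *)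
have [s sF sc] : exists2 s : {perm T}, s \in F & s c.1 = c.2.
  have [|u _ uB] := @perm_avoid _ s0 set0 [:: s0].
    by rewrite setC0 cardsT (leq_trans _ T4).
  have uF : u \notin F.
    apply/negP => /(intF _ _ s0F)[x ex].
    by have := uB x; rewrite inE => /(_ isT s0 (mem_head _ _)); rewrite ex eqxx.
  have [x [y [v [st _]]]] := exists_strong s0F uF.
  have /existsP[t /and5P[/eqP tx /eqP ty _ tF _]] := st.
  by exists t => //; case/orP: (cP _ _ st) => /eqP<-.
(* If [u] were outside [F], going from [u] to [s] would give a strong pair away from [c.1], where
   they agree. *)
have sub (u : {perm T}) : u c.1 = c.2 -> u \in F.
  move=> uc; apply/negPn/negP => uF.
  have [x [y [v [st vz]]]] := exists_strong sF uF.
  have [|_ cx cy] := vz c.1; first by rewrite uc sc.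
  by case/orP: (cP _ _ st) => /eqP e; [move: cx|move: cy]; rewrite -e eqxx.
exists c.1, c.2; apply/setP => t; rewrite inE; apply/idP/eqP => [tF|/sub //].
have [|u uA uB] := @perm_avoid _ s [set c.1] [:: t].
  by rewrite cardsCs setCK cards1 leq_subRL // (leq_trans _ T4).
have uc : u c.1 = c.2 by rewrite uA ?sc // inE.
have [x ex] := intF _ _ tF (sub u uc).
have [xc|xc] := eqVneq x c.1; first by rewrite -xc ex xc.
by have := uB x; rewrite inE => /(_ xc t (mem_head _ _)); rewrite ex eqxx.
Qed.

(** * The symmetries of K(n_1, ..., n_k) *)

Lemma perm_extend (I T : finType) (D : {set I}) (u v : I -> T) :
    {in D &, injective u} -> {in D &, injective v} ->
  exists s : {perm T}, {in D, forall d, s (u d) = v d}.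
Proof.
have [m] := ubnP #|D|; elim: m D => // m IH D leDm iu iv.
have [->|[d dD]] := set_0Vmem D; first by exists 1%g => x; rewrite inE.
have sD : {subset D :\ d <= D} by move=> x; rewrite inE => /andP[].
have [|||s sP] := IH (D :\ d).
- by move: leDm; rewrite (cardsD1 d D) dD add1n ltnS.
- exact: sub_in2 iu.
- exact: sub_in2 iv.
exists (s * tperm (s (u d)) (v d))%g => x xD; rewrite permM.
have [->|xd] := eqVneq x d; first by rewrite tpermL.
have xD' : x \in D :\ d by rewrite !inE xd.
have ne1 : s (u d) != s (u x) by rewrite (inj_eq perm_inj) (inj_in_eq iu) // eq_sym.
have ne2 : v d != s (u x) by rewrite sP // (inj_in_eq iv) // eq_sym.
by rewrite tpermD // sP.
Qed.

Section Kpartite.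
Variables (k : nat) (n : 'I_k -> nat).
Implicit Types (e x y : edge n) (M : {set edge n}) (F : {set {set edge n}}).

Definition symm := {dffun forall i : 'I_k, {perm 'I_(n i)}}.
Implicit Types (g h : symm).

Definition act g e : edge n := [ffun i => g i (e i)].
Definition act_set g M := [set act g e | e in M].
Definition symm_mul g h : symm := [ffun i => (g i * h i)%g].

Lemma actM g h e : act (symm_mul g h) e = act h (act g e).
Proof. by apply/ffunP => i; rewrite !ffunE permM. Qed.

Lemma act_setM g h M : act_set (symm_mul g h) M = act_set h (act_set g M).
Proof. by rewrite /act_set -imset_comp; apply: eq_imset => e; rewrite /= actM. Qed.

Lemma act_inj g : injective (act g).
Proof.
by move=> e f /ffunP E; apply/ffunP => i; have := E i; rewrite !ffunE => /perm_inj.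
Qed.

Lemma act_set_inj g : injective (act_set g).
Proof. exact/imset_inj/act_inj. Qed.

Lemma symm_mul_injr h : injective (symm_mul^~ h).
Proof.
by move=> g g' /ffunP E; apply/ffunP => i; have := E i; rewrite !ffunE => /mulIg.
Qed.

Lemma matchingsP r M : reflect
  (#|M| = r /\ forall e f, e \in M -> f \in M -> forall i, e i = f i -> e = f)
  (M \in matchings n r).
Proof.
rewrite inE; apply: (iffP andP) => -[/eqP cM H]; split=> //.
  move=> e f eM fM i ei; apply/eqP; apply: contraT => ef.
  have /forall_inP/(_ f fM)/implyP/(_ ef)/forallP/(_ i) := forall_inP H e eM.
  by rewrite ei eqxx.
apply/forall_inP => e eM; apply/forall_inP => f fM; apply/implyP => ef.
by apply/forallP => i; apply: contraNneq ef => /(H _ _ eM fM)/eqP.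
Qed.

Lemma act_set_matching r g M : M \in matchings n r -> act_set g M \in matchings n r.
Proof.
case/matchingsP => cM iM; apply/matchingsP; split; first by rewrite card_imset //; apply: act_inj.
move=> _ _ /imsetP[e eM ->] /imsetP[f fM ->] i; rewrite !ffunE => /perm_inj ei.
by rewrite (iM e f eM fM i).
Qed.

Lemma act_set_transitive r M M' : M \in matchings n r -> M' \in matchings n r ->
  exists g, act_set g M = M'.
Proof.
case/matchingsP => cM iM /matchingsP[cM' iM'].
have [M0|[e0 e0M]] := set_0Vmem M'.
  exists [ffun i => 1%g]; apply/eqP; rewrite M0 -cards_eq0 card_imset; last exact: act_inj.
  by rewrite cM -cM' M0 cards0.
pose beta x := nth e0 (enum M') (index x (enum M)).
have lti x : x \in M -> index x (enum M) < size (enum M').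
  by move=> xM; rewrite -cardE cM' -cM cardE index_mem mem_enum.
have bM x : x \in M -> beta x \in M'.
  by move=> xM; rewrite -mem_enum mem_nth // lti.
have bi : {in M &, injective beta}.
  move=> x y xM yM /eqP; rewrite nth_uniq ?lti ?enum_uniq // => /eqP.
  move/(congr1 (nth e0 (enum M))); rewrite !nth_index ?mem_enum //.
have ex l : exists s : {perm 'I_(n l)}, {in M, forall x, s (x l) = beta x l}.
  apply: perm_extend => x y xM yM; first exact: iM.
  by move/(iM' _ _ (bM _ xM) (bM _ yM)); apply: bi.
have [gs gP] := fin_all_exists ex.
exists [ffun l => gs l]; apply/eqP; rewrite eqEcard; apply/andP; split.
  apply/subsetP => _ /imsetP[x xM ->].
  by rewrite (_ : act _ _ = beta x) ?bM //; apply/ffunP => l; rewrite !ffunE gP.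
by rewrite card_imset ?cM ?cM' //; apply: act_inj.
Qed.

Lemma card_symm_gt0 : 0 < #|{: symm}|.
Proof. by apply/card_gt0P; exists [ffun i => 1%g]. Qed.

(** By transitivity every matching is the image of [M] under equally many symmetries. The proportion
    is stated cross-multiplied, to stay in [nat]. *)
Lemma card_act_in r F M : F \subset matchings n r -> M \in matchings n r ->
  #|[set g : symm | act_set g M \in F]| * #|matchings n r| = #|F| * #|{: symm}|.
Proof.
move=> sF MX; pose c N := #|[set g : symm | act_set g M == N]|.
have cle N N' : N \in matchings n r -> N' \in matchings n r -> c N <= c N'.
  move=> NX N'X; have [h hN] := act_set_transitive NX N'X.
  rewrite /c -(card_imset _ (@symm_mul_injr h)); apply: subset_leq_card.
  by apply/subsetP => _ /imsetP[g + ->]; rewrite !inE act_setM => /eqP->; rewrite hN.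
have cc N : N \in matchings n r -> c N = c M.
  by move=> NX; apply/eqP; rewrite eqn_leq !cle.
have sumc (A : {set {set edge n}}) : A \subset matchings n r ->
    #|[set g : symm | act_set g M \in A]| = #|A| * c M.
  move=> sA; rewrite -sum_nat_const -sum1_card.
  rewrite (partition_big (fun g => act_set g M) (mem A)) /= => [|g]; last by rewrite inE.
  apply: eq_bigr => N NA; rewrite -(cc N) ?(subsetP sA) // sum1_card.
  by apply: eq_card => g; rewrite unfold_in !inE; apply: andb_idl => /eqP->.
rewrite sumc // mulnAC -mulnA -sumc //; congr (_ * _).
by rewrite -cardsT; apply: eq_card => g; rewrite in_setT in_set act_set_matching.
Qed.

Lemma double_count r F (D : edge n -> {set edge n}) : F \subset matchings n r ->
    (forall e, D e \in matchings n r) ->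
  (\sum_(g : symm) #|[set e | act_set g (D e) \in F]|) * #|matchings n r| =
    #|{: edge n}| * #|F| * #|{: symm}|.
Proof.
move=> sF DX; under eq_bigr do rewrite -sum1_card big_mkcond.
rewrite exchange_big /= big_distrl /= -mulnA -sum_nat_const; apply: eq_bigr => e _.
rewrite -(card_act_in sF (DX e)); congr (_ * _).
by rewrite -sum1_card [RHS]big_mkcond /=; apply: eq_bigr => g _; rewrite !inE.
Qed.

(** [D] is the frame, one matching per edge. By [card_star_mul] this bounds [#|F|] by the size of a
    star. *)
Lemma average_le r F (D : edge n -> {set edge n}) : F \subset matchings n r ->
    (forall e, D e \in matchings n r) ->
    (forall g, #|[set e | act_set g (D e) \in F]| <= r) ->
  #|F| * #|{: edge n}| <= r * #|matchings n r|.
Proof.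
move=> sF DX le; rewrite -(leq_pmul2r card_symm_gt0) [#|F| * _]mulnC.
rewrite -(double_count sF DX) mulnAC leq_mul2r orbC.
by rewrite mulnC -sum_nat_const leq_sum.
Qed.

Lemma average_eq r F (D : edge n -> {set edge n}) : F \subset matchings n r ->
    (forall e, D e \in matchings n r) ->
    (forall g, #|[set e | act_set g (D e) \in F]| <= r) ->
    0 < #|matchings n r| ->
    #|F| * #|{: edge n}| = r * #|matchings n r| ->
  forall g, #|[set e | act_set g (D e) \in F]| = r.
Proof.
move=> sF DX le X0 eqF g; apply/eqP; rewrite eqn_leq le /= leqNgt; apply/negP => lt.
have := double_count sF DX; rewrite [#|{: edge n}| * _]mulnC eqF mulnAC.
move/eqP; rewrite eqn_pmul2r // => /eqP eS.
have : \sum_(h : symm) #|[set e | act_set h (D e) \in F]| < \sum_(h : symm) r.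
  rewrite (bigD1 g) //= [X in _ < X](bigD1 g) //= -addSn leq_add //.
  exact: leq_sum.
by rewrite eS sum_nat_const mulnC ltnn.
Qed.

Lemma card_star_const r e e' : #|star r e| = #|star r e'|.
Proof.
suff le x y : #|star r x| <= #|star r y| by apply/eqP; rewrite eqn_leq !le.
pose g : symm := [ffun i => tperm (x i) (y i)].
have gx : act g x = y by apply/ffunP => i; rewrite !ffunE tpermL.
rewrite -(card_imset _ (@act_set_inj g)); apply: subset_leq_card.
apply/subsetP => _ /imsetP[M + ->]; rewrite /star in_set => /andP[MX xM].
by rewrite in_set act_set_matching //= -gx imset_f.
Qed.

(** Incidences between edges and matchings are counted in two ways, all stars having the same
    size. *)
Lemma card_star_mul r e : #|star r e| * #|{: edge n}| = r * #|matchings n r|.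
Proof.
rewrite mulnC -sum_nat_const.
under eq_bigr => e' _ do rewrite (card_star_const r e e') -sum1_card big_mkcond.
rewrite exchange_big /= mulnC -sum_nat_const [RHS]big_mkcond /=.
apply: eq_bigr => M _; rewrite /star; have [MX|nX] := boolP (M \in matchings n r).
  case/matchingsP: (MX) => cM _; rewrite -[RHS]cM -sum1_card [RHS]big_mkcond.
  by apply: eq_bigr => x _; rewrite in_set MX.
by rewrite big1 // => x _; rewrite in_set (negPf nX).
Qed.

Lemma card_edge : #|{: edge n}| = \prod_i n i.
Proof.
rewrite card_dep_ffun foldrE big_map big_enum /=.
by apply: eq_bigr => i _; rewrite card_ord.
Qed.

(** Ordered matchings are counted twice: as a choice of an injective [r]-tuple in each part, and as
    [r]! orderings of each matching. The part [i0] ensures that the edges of an ordered matching are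
    distinct. *)
Lemma card_matchings (i0 : 'I_k) r : #|matchings n r| * r`! = \prod_i (n i) ^_ r.
Proof.
pose P := [set p : {ffun 'I_r -> edge n} | [forall l, injectiveb (fun j => p j l)]].
have PP (p : {ffun 'I_r -> edge n}) : reflect (forall l, injective (fun j => p j l)) (p \in P).
  by rewrite inE; apply: (iffP forallP) => H l; apply/injectiveP; apply: H.
have <- : #|P| = \prod_i (n i) ^_ r.
  pose inj_col l := {f : {ffun 'I_r -> 'I_(n l)} | injectiveb f}.
  pose phi (q : {dffun forall l, inj_col l}) : {ffun 'I_r -> edge n} :=
    [ffun j => [ffun l => val (q l) j]].
  have phi_inj : injective phi.
    move=> q q' /ffunP E; apply/ffunP => l; apply/val_inj/ffunP => j.
    by have /ffunP/(_ l) := E j; rewrite !ffunE.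
  have -> : #|P| = #|[set phi q | q : {dffun forall l, inj_col l}]|.
    apply: eq_card => p; apply/PP/imsetP => [H|[q _ ->] l].
      have Hl l : injectiveb [ffun j => p j l].
        by apply/injectiveP => j j'; rewrite !ffunE; apply: H.
      exists [ffun l => exist _ [ffun j => p j l] (Hl l)] => //.
      by apply/ffunP => j; apply/ffunP => l; rewrite !ffunE.
    by move=> j j'; rewrite !ffunE; apply/injectiveP: j j'; apply: (valP (q l)).
  rewrite card_imset // card_dep_ffun foldrE big_map big_enum /=.
  apply: eq_bigr => l _.
  rewrite card_sig -[X in _ ^_ X]card_ord -[X in X ^_ _]card_ord -card_inj_ffuns.
  by apply: eq_card => f; rewrite !inE.
rewrite -[RHS]sum1_card.
rewrite (partition_big (fun p : {ffun 'I_r -> edge n} => [set p j | j : 'I_r])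
  (mem (matchings n r))) /=.
  rewrite -sum_nat_const; apply: eq_bigr => M MX; rewrite sum1_card.
  have [cM iM] := matchingsP _ _ MX.
  have -> : r`! = #|[set f : {ffun 'I_r -> edge n} in ffun_on (mem M) | injectiveb f]|.
    by rewrite card_inj_ffuns_on cM card_ord ffactnn.
  apply: eq_card => p; rewrite [RHS]unfold_in in_set; apply/andP/andP => -[].
    move=> /ffun_onP pM /injectiveP ip; split; last first.
      rewrite eqEcard card_imset // card_ord cM leqnn andbT.
      by apply/subsetP => _ /imsetP[j _ ->]; apply: pM.
    by apply/PP => l j j' e; apply/ip/(iM _ _ _ _ l e); apply: pM.
  move=> /PP ip /eqP eM; split.
    by apply/ffun_onP => j; rewrite -eM imset_f.
  by apply/injectiveP => j j' e; apply: (ip i0); rewrite e.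
move=> p /PP ip; apply/matchingsP; split.
  by rewrite card_imset ?card_ord // => j j' e; apply: (ip i0); rewrite e.
by move=> _ _ /imsetP[j _ ->] /imsetP[j' _ ->] l /ip->.
Qed.

Lemma card_star (i0 : 'I_k) r e : 0 < r -> (forall i, 0 < n i) ->
  #|star r e| * (r.-1)`! = \prod_i (n i).-1 ^_ r.-1.
Proof.
move=> r0 n0; apply/eqP.
have E0 : 0 < #|{: edge n}| by rewrite card_edge prodn_gt0.
rewrite -(eqn_pmul2r E0) mulnAC card_star_mul.
have -> : r * #|matchings n r| * (r.-1)`! = #|matchings n r| * r`!.
  by rewrite -{5}(prednK r0) factS prednK // mulnCA mulnA.
rewrite card_matchings // card_edge mulnC -big_split /=; apply/eqP/eq_bigr => i _.
by rewrite -{1}(prednK (n0 i)) -{1}(prednK r0) ffactSS prednK.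
Qed.
End Kpartite.

(** * The Katona frame *)

Lemma modn_close m x y : x = y %[mod m] -> x < y + m -> y < x + m -> x = y.
Proof.
wlog le : x y / x <= y => [H|] e xy yx.
  have [/H|/ltnW le] := leqP x y; first exact.
  by apply/esym/H.
move/eqP: e; rewrite eq_sym eqn_mod_dvd // => dv.
have := dvdn_leq _ dv; lia.
Qed.

(* Katona's circle argument: measured from one of them, the starting points of
   pairwise intersecting arcs of length [r] lie in an interval of length [2r-1]
   and differ by less than [r] there, since the circle has length at least [3r]. *)
Lemma circular_arcs (L r : nat) (T : {set 'I_L}) : 0 < r -> 3 * r <= L ->
    (forall t t' : 'I_L, t \in T -> t' \in T ->
      exists j j', [/\ j < r, j' < r & t + j = t' + j' %[mod L]]) ->
  #|T| <= r /\ (#|T| = r -> exists u, forall j, j < r -> 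
    exists2 t : 'I_L, t \in T & t = u + j %[mod L]).
Proof.
move=> r0 rL HT.
have near (t t' : 'I_L) : t \in T -> t' \in T ->
    (t < t' + r /\ t' < t + r) \/ (L + t' < t + r \/ L + t < t' + r).
  move=> tT t'T; have [j [j' [jr jr' e]]] := HT t t' tT t'T.
  have := ltn_ord t; have := ltn_ord t' => t'L tL.
  have [lt|ge] := ltnP (t + j) (t' + j' + L).
    have [lt'|ge'] := ltnP (t' + j') (t + j + L).
      by have := modn_close e lt lt'; lia.
    by lia.
  by lia.
have [->|[t0 t0T]] := set_0Vmem T; first by rewrite cards0; split=> // e; rewrite -e in r0.
(* The signed distance from [t0] to [t] around the circle, shifted by [r - 1] to be a natural
   number. *)
pose phi (t : 'I_L) : nat := if t + r <= t0 then t + L + r - t0.+1 else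
  if t0 + r <= t then t + r - L - t0.+1 else t + r - t0.+1.
have phiE (t : 'I_L) : t \in T -> [\/ L + t < t0 + r /\ phi t + t0.+1 = t + L + r,
    L + t0 < t + r /\ phi t + L + t0.+1 = t + r |
    [/\ t < t0 + r, t0 < t + r & phi t + t0.+1 = t + r]].
  move=> tT; have nt := near t t0 tT t0T; have tL := ltn_ord t; have t0L := ltn_ord t0.
  rewrite /phi; case: (leqP (t + r) t0) => h1; first by apply: Or31; split=> //; lia.
  case: (leqP (t0 + r) t) => h2; first by apply: Or32; split=> //; lia.
  by apply: Or33; split=> //; lia.
have phi_near (t t' : 'I_L) : t \in T -> t' \in T -> phi t < phi t' + r.
  move=> tT t'T; have nt := near t t' tT t'T.
  have := ltn_ord t; have := ltn_ord t'; have := ltn_ord t0.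
  by case: (phiE t tT) => [[]|[]|[]]; case: (phiE t' t'T) => [[]|[]|[]]; lia.
have phi_inj : {in T &, injective phi}.
  move=> t t' tT t'T e; apply: val_inj => /=.
  have := ltn_ord t; have := ltn_ord t'; have := ltn_ord t0.
  by case: (phiE t tT) => [[]|[]|[]]; case: (phiE t' t'T) => [[]|[]|[]]; lia.
pose tm := [arg min_(t < t0 in T) phi t].
have [tmT tmle] : tm \in T /\ forall t, t \in T -> phi tm <= phi t.
  by rewrite /tm; case: arg_minnP.
have lt t : t \in T -> phi t - phi tm < r.
  move=> tT; have := phi_near t tm tT tmT; have := tmle t tT; lia.
case: r r0 rL HT near phi phiE phi_near phi_inj tm tmT tmle lt => //.
move=> r _ rL _ near phi phiE phi_near phi_inj tm tmT tmle lt.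
pose psi t : 'I_r.+1 := inord (phi t - phi tm).
have psi_inj : {in T &, injective psi}.
  move=> t t' tT t'T /(congr1 val); rewrite /= !inordK ?lt // => e.
  apply: phi_inj => //; have := tmle t tT; have := tmle t' t'T; lia.
have cpsi : #|psi @: T| = #|T| by rewrite card_in_imset.
split; first by rewrite -cpsi -[X in _ <= X]card_ord max_card.
(* [r] now stands for the arc length minus one, so this undoes the shift in [phi]; adding [L]
   prevents truncation. *)
move=> cT; exists (phi tm + t0 + L - r) => j jr.
have : inord j \in psi @: T.
  suff -> : psi @: T = setT by [].
  by apply/eqP; rewrite eqEcard subsetT cardsT card_ord cpsi cT leqnn.
case/imsetP => t tT /(congr1 val); rewrite /= !inordK ?lt // => ej.
exists t => //.
have ephi : phi t = phi tm + j by have := tmle t tT; lia.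
have tL := ltn_ord t; have t0L := ltn_ord t0.
case: (phiE t tT) => [[h e]|[h e]|[h h' e]].
- by rewrite (_ : _ + j = 2 * L + t) ?modnMDl //; lia.
- by congr (_ %% _); lia.
- by rewrite (_ : _ + j = 1 * L + t) ?modnMDl //; lia.
Qed.

Section Frame.
Variables (k : nat) (n : 'I_k -> nat) (a b : 'I_k) (r : nat).
Hypothesis npos : forall l, 0 < n l.
Implicit Types (e z s : edge n) (M : {set edge n}) (F : {set {set edge n}}).
Implicit Types (g h : symm n).

(** Reduction modulo [n l] lets positions be computed in [nat], cyclically in every part. *)
Definition vertex l (x : nat) : 'I_(n l) := Ordinal (ltn_pmod x (npos l)).

Lemma vertex_id l (x : 'I_(n l)) : vertex l x = x.
Proof. by apply: val_inj; rewrite /= modn_small. Qed.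

Definition diag_edge (i : nat) : edge n := [ffun l => vertex l i].
Definition diag : {set edge n} := [set diag_edge i | i : 'I_(n a)].

Lemma rot_subproof l (c : nat) : injective (fun x : 'I_(n l) => vertex l (c + x)).
Proof.
move=> x y /(congr1 val) /= e; apply: val_inj => /=.
have := ltn_ord x; have := ltn_ord y => yl xl.
have := @modn_close (n l) (c + x) (c + y) e; lia.
Qed.
Definition rot l c : {perm 'I_(n l)} := perm (@rot_subproof l c).

Lemma rotE l c (x : 'I_(n l)) : rot l c x = vertex l (c + x). Proof. by rewrite permE. Qed.

Lemma rot0 l : rot l 0 = 1%g.
Proof. by apply/permP => x; rewrite rotE perm1 add0n vertex_id. Qed.

Definition rotate g s : symm n := [ffun l => (rot l (s l) * g l)%g].

Lemma act_rotate g s (i : nat) l :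
  act (rotate g s) (diag_edge i) l = g l (vertex l (s l + i)).
Proof.
rewrite !ffunE permM rotE; congr (g l _).
by apply: val_inj; rewrite /= modnDmr.
Qed.

Hypotheses (ba : b != a) (n_min : forall l, n a <= n l).
Hypotheses (r0 : 0 < r) (ra : r <= n a).

Lemma vertex_small l (i : 'I_(n a)) : vertex l i = i :> nat.
Proof. by rewrite /= modn_small // (leq_trans (ltn_ord i)). Qed.

Lemma vertex_inj l (i j : 'I_(n a)) : vertex l i = vertex l j -> i = j.
Proof. by move/(congr1 (@nat_of_ord _)); rewrite !vertex_small => /val_inj. Qed.

(** Rotations of the diagonal that fix part [a] are edge-disjoint, since the vertex in part [a]
    reveals the index and then every shift. *)
Lemma rotate_inj g s s' (i i' : 'I_(n a)) : s a = 0 :> nat -> s' a = 0 :> nat ->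
  act (rotate g s) (diag_edge i) = act (rotate g s') (diag_edge i') -> i = i' /\ s = s'.
Proof.
move=> sa sa' /ffunP E.
have {}E l : s l + i = s' l + i' %[mod n l].
  by have := E l; rewrite !act_rotate => /perm_inj/(congr1 val).
have ii : i = i'.
  apply: val_inj; have := E a; by rewrite sa sa' !add0n !modn_small.
split=> //; apply/ffunP => l; apply: val_inj => /=.
have := ltn_ord (s l); have := ltn_ord (s' l).
by have := modn_close (E l); rewrite ii; lia.
Qed.

Definition good F g := [exists M in F, M \subset act_set g diag].

(* [cell z t] is the edge at position [t] of a circle of length [n a * n b]:
   all coordinates advance together for [n a] steps, then part [a] restarts
   and part [b] is shifted by one, so that [n a - 1] consecutive edges are
   pairwise disjoint. The circle depends on the coordinates of [z] outside
   [a] and [b] only. *)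
Definition offset z (q : nat) l := if l == a then 0 else if l == b then q else z l : nat.
Definition cell z (t : nat) : edge n := [ffun l => vertex l (offset z (t %/ n a) l + t %% n a)].
Definition arc z (t : nat) : {set edge n} := [set cell z (t + j) | j : 'I_r].
(** An edge serves as a name for an arc: its vertices in parts [a] and [b] give the starting time,
    the others the circle. The arc need not contain the edge. *)
Definition time e : nat := e a + n a * e b.

Lemma time_mod e : time e %% n a = e a.
Proof. by rewrite /time addnC mulnC modnMDl modn_small. Qed.

Lemma time_div e : time e %/ n a = e b.
Proof. by rewrite /time addnC mulnC divnMDl // divn_small // addn0. Qed.

Lemma time_lt e : time e < n a * n b.
Proof.
have := ltn_ord (e a); have := ltn_ord (e b); rewrite /time => eb ea.
apply: (@leq_trans (n a * (e b).+1)); last by rewrite leq_mul2l eb orbT.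
by rewrite mulnS ltn_add2r.
Qed.

Lemma arc_matching z t : r < n a -> arc z t \in matchings n r.
Proof.
move=> ltra.
have inj l (j j' : 'I_r) : cell z (t + j) l = cell z (t + j') l -> j = j'.
  wlog le : j j' / j <= j' => [H|].
    by have [/H//|/ltnW le /esym e] := leqP j j'; apply/esym/H.
  rewrite !ffunE => /(congr1 val) /=.
  have [q0 q1] := (divn_eq (t + j) (n a), divn_eq (t + j') (n a)).
  have [u0 u1] := (ltn_pmod (t + j) (npos a), ltn_pmod (t + j') (npos a)).
  have lj := ltn_ord j'; have nl := n_min l; rewrite /offset.
  move: ((t + j) %/ n a) ((t + j') %/ n a) ((t + j) %% n a) ((t + j') %% n a) q0 q1 u0 u1.
  move=> q q' u u' e e' lu lu' em; apply/val_inj/eqP.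
  rewrite eqn_leq le leqNgt /=; apply/negP => ltj.
  (* The positions differ by less than [r], hence part [a] restarts at most once between them. If it
     does, [r < n a] keeps the residues more than one apart, so the shift of part [b] by one causes
     no collision. *)
  have [qq|qq] : q' = q \/ q' = q.+1 by nia.
    rewrite {q'}qq in e' em.
    have : u = u' by move: em; case: ifP => _; [|case: ifP => _]; move/modn_close; lia.
    lia.
  rewrite {q'}qq mulSn in e' em.
  have : u' + 1 < u by lia.
  by move: em; case: ifP => _; [|case: ifP => _]; move/modn_close; lia.
apply/matchingsP; split.
  rewrite card_imset ?card_ord // => j j' e.
  by apply: (inj a); rewrite e.
by move=> _ _ /imsetP[j _ ->] /imsetP[j' _ ->] l /inj->.
Qed.

Lemma cell_inj z z' t t' : cell z t = cell z' t' ->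
  t = t' %[mod n a * n b] /\ forall l, l != a -> l != b -> z l = z' l.
Proof.
move=> /ffunP E.
have {}E l : offset z (t %/ n a) l + t %% n a = offset z' (t' %/ n a) l + t' %% n a %[mod n l].
  by have := E l; rewrite !ffunE => /(congr1 val).
have tt : t %% n a = t' %% n a.
  by have := E a; rewrite /offset eqxx !add0n !modn_mod.
split=> [|l la lb].
  have := E b; rewrite /offset (negPf ba) eqxx tt => /eqP.
  rewrite eqn_modDr => /eqP em.
  rewrite (divn_eq t (n a)) (divn_eq t' (n a)) tt; apply/eqP; rewrite eqn_modDr.
  by rewrite [n a * n b]mulnC -!muln_modl em.
apply: val_inj => /=; have := E l; rewrite /offset (negPf la) (negPf lb) tt => /modn_close.
have := ltn_ord (z l); have := ltn_ord (z' l); lia.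
Qed.

Lemma diag_matching : n a = r -> diag \in matchings n r.
Proof.
move=> ea; have inj l (i j : 'I_(n a)) : diag_edge i l = diag_edge j l -> i = j.
  by rewrite !ffunE; apply: vertex_inj.
apply/matchingsP; split.
  by rewrite card_imset ?card_ord // => i j e; apply: (inj a); rewrite e.
by move=> _ _ /imsetP[i _ ->] /imsetP[j _ ->] l /inj->.
Qed.

Lemma katona_frame F : F \subset matchings n r -> intersecting F ->
  exists D : edge n -> {set edge n}, (forall e, D e \in matchings n r) /\
    forall g, #|[set e | act_set g (D e) \in F]| <= r /\
     (#|[set e | act_set g (D e) \in F]| = r -> 
        exists s, s a = 0 :> nat /\ good F (rotate g s)).
Proof.
move=> sF intF; have [ar|ltra] := eqVneq (n a) r.
  (* Forgetting the vertex in part [a] gives each rotated diagonal [n a] names, that is, [r] of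
     them. Disjoint diagonals cannot both be in [F], so at most these [r] names count. *)
  pose s0 e : edge n := [ffun l => if l == a then vertex l 0 else e l].
  have s0a e : s0 e a = 0 :> nat by rewrite ffunE eqxx /= mod0n.
  pose D e := act_set (rotate [ffun => 1%g] (s0 e)) diag.
  have actD g e : act_set g (D e) = act_set (rotate g (s0 e)) diag.
    by rewrite -act_setM; congr (act_set _ _); apply/ffunP => l; rewrite !ffunE mulg1.
  exists D; split=> [e|g]; first exact/act_set_matching/diag_matching.
  split.
    pose pr e := cast_ord ar (e a).
    rewrite -[X in _ <= X]card_ord -(@card_in_imset _ _ pr); first exact: max_card.
    move=> e e'; rewrite !inE !actD => eF e'F /cast_ord_inj ea.
    have [_ [/imsetP[_ /imsetP[i _ ->] ->] /imsetP[_ /imsetP[i' _ ->]]]] := intF _ _ eF e'F.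
    move/(rotate_inj (s0a e) (s0a e')) => [_ /ffunP es]; apply/ffunP => l.
    have [->//|la] := eqVneq l a.
    by have := es l; rewrite !ffunE (negPf la).
  move=> cr; have /card_gt0P[e] : 0 < #|[set e | act_set g (D e) \in F]| by rewrite cr.
  rewrite inE actD => eF; exists (s0 e); split=> //.
  by apply/existsP; exists (act_set (rotate g (s0 e)) diag); rewrite eF subxx.
have {}ltra : r < n a by rewrite ltn_neqAle eq_sym ltra.
exists (fun e => arc e (time e)); split=> [e|g]; first exact: arc_matching.
set A := [set e | _].
have Aint e e' : e \in A -> e' \in A -> exists j j', [/\ j < r, j' < r &
    cell e (time e + j) = cell e' (time e' + j')].
  rewrite !inE => eF e'F.
  have [_ [/imsetP[_ /imsetP[j _ ->] ->] /imsetP[_ /imsetP[j' _ ->]]]] := intF _ _ eF e'F.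
  by move/act_inj => E; exists j, j'.
pose tord e := Ordinal (time_lt e).
(* Intersecting arcs lie on the same circle, so within [A] the starting time determines the edge. *)
have tinj : {in A &, injective tord}.
  move=> e e' eA e'A /(congr1 val) /= et.
  have [j [j' [_ _ /cell_inj[_ E]]]] := Aint e e' eA e'A.
  apply/ffunP => l; have [->|la] := eqVneq l a.
    by apply: val_inj; rewrite /= -!time_mod et.
  have [->|lb] := eqVneq l b; last exact: E.
  by apply: val_inj; rewrite /= -!time_div et.
have [||le eqr] := @circular_arcs (n a * n b) r (tord @: A) r0.
- by have := n_min b; nia.
- move=> _ _ /imsetP[e eA ->] /imsetP[e' e'A ->] /=.
  have [j [j' [jr jr' /cell_inj[E _]]]] := Aint e e' eA e'A.
  by exists j, j'.
rewrite card_in_imset // in le eqr; split=> // /eqr[u uP].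
(* Among [r] consecutive starting times one yields an arc without restart of part [a]: the first, or
   else the next multiple of [n a]. Such an arc lies in a single rotated diagonal. *)
have [j jr ju] : exists2 j, j < r & (u + j) %% n a + r <= n a.
  have eu := divn_eq u (n a); have lu := ltn_pmod u (npos a).
  have [le1|gt1] := leqP (u %% n a + r) (n a); first by exists 0; rewrite ?addn0.
  exists (n a - u %% n a); first by lia.
  rewrite (_ : u + _ = (u %/ n a).+1 * n a); last by rewrite mulSn; lia.
  by rewrite modnMl add0n.
have [_ /imsetP[e eA ->] /= et] := uP j jr.
have ea : e a + r <= n a.
  rewrite -time_mod -(modn_dvdm _ (dvdn_mulr (n b) (dvdnn (n a)))) et.
  by rewrite modn_dvdm ?dvdn_mulr.
pose s : edge n := [ffun l => vertex l (offset e (e b) l)].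
exists s; split; first by rewrite ffunE /offset eqxx /= mod0n.
apply/existsP; exists (act_set g (arc e (time e))); move: eA; rewrite inE => -> /=.
apply/subsetP => _ /imsetP[_ /imsetP[i _ ->] ->].
have lti : e a + i < n a by have := ltn_ord i; lia.
apply/imsetP; exists (diag_edge (Ordinal lti)); first exact: imset_f.
apply/ffunP => l; rewrite act_rotate !ffunE; congr (g l _); apply: val_inj => /=.
have -> : (time e + i) %/ n a = e b.
  by rewrite /time addnAC addnC mulnC divnMDl // divn_small // addn0.
have -> : (time e + i) %% n a = e a + i.
  by rewrite /time addnAC addnC mulnC modnMDl modn_small.
by rewrite modnDml.
Qed.


Definition set_part h (p : {perm 'I_(n b)}) : symm n := [ffun l => dfwith (fun l => h l) p l].

Lemma set_part_in h p : set_part h p b = p.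
Proof. by rewrite ffunE dfwith_in. Qed.

Lemma set_part_out h p l : l != b -> set_part h p l = h l.
Proof. by move=> lb; rewrite ffunE dfwith_out // eq_sym. Qed.

Lemma set_part_id h : set_part h (h b) = h.
Proof.
apply/ffunP => l; have [->|lb] := eqVneq l b; first by rewrite set_part_in.
by rewrite set_part_out.
Qed.

(** * Families attaining the bound: reduction to permutations of part [b] *)

Section Extremal.
Variable F : {set {set edge n}}.
Hypotheses (intF : intersecting F) (nb3 : 3 <= n b).

(** Members inside the two diagonals share an edge; as [g] and [h] agree on part [a], it has the
    same index in both. *)
Lemma good_meet g h : good F g -> good F h -> g a = h a ->
  exists i : 'I_(n a), forall l, g l (vertex l i) = h l (vertex l i).
Proof.
case/existsP => M /andP[MF /subsetP sM] /existsP[M' /andP[M'F /subsetP sM']] ga.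
have [e [/sM eM /sM']] := intF MF M'F; case/imsetP: eM => _ /imsetP[i _ ->] ->.
case/imsetP => _ /imsetP[i' _ ->] /ffunP E; exists i => l.
have := E a; rewrite !ffunE ga => /perm_inj/vertex_inj ii.
by have := E l; rewrite !ffunE -ii.
Qed.

Hypothesis allgood : forall g, exists s, s a = 0 :> nat /\ good F (rotate g s).

Lemma good_set_part h : good F h -> exists i : 'I_(n a), forall p,
  good F (set_part h p) = (p (vertex b i) == h b (vertex b i)).
Proof.
move=> hF; pose S := [set p | good F (set_part h p)].
have ha p : set_part h p a = h a by rewrite set_part_out // eq_sym.
(* Some rotation of the diagonal of [set_part h p] is good. It meets that of [h], which forces its
   shifts outside part [b] to be zero. *)
have rotS p : exists q : 'I_(n b), (rot b q * p)%g \in S.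
  have [s [sa]] := allgood (set_part h p) => gs; exists (s b); rewrite inE.
  have [|i iP] := good_meet gs hF; first by rewrite ffunE sa rot0 mul1g ha.
  have s0 l : l != b -> s l = 0 :> nat.
    move=> lb; have := iP l; rewrite ffunE permM rotE set_part_out // => /perm_inj/(congr1 val) /=.
    rewrite modnDmr -[in RHS](add0n i) => /modn_close; have := ltn_ord (s l); lia.
  rewrite (_ : set_part h _ = rotate (set_part h p) s) //; apply/ffunP => l.
  have [->|lb] := eqVneq l b; first by rewrite ffunE dfwith_in [RHS]ffunE set_part_in.
  by rewrite set_part_out // ffunE set_part_out // s0 // rot0 mul1g.
(* Each of the [n b]! permutations enters [S] after one of only [n b] rotations. *)
have cS : #|'I_(n b)|.-1`! <= #|S|.
  rewrite -(leq_pmul2l (npos b)) card_ord -{1}(prednK (npos b)) -factS prednK //.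
  rewrite -[X in X`!]card_ord -card_perms.
  apply: (@leq_trans (\sum_(p : {perm 'I_(n b)}) 1)); first by rewrite sum1_card.
  apply: (@leq_trans (\sum_(p : {perm 'I_(n b)}) \sum_(q < n b) ((rot b q * p)%g \in S))).
    by apply: leq_sum => p _; have [q qS] := rotS p; rewrite (bigD1 q) //= qS.
  rewrite exchange_big /= -[X in _ <= X * _]card_ord -sum_nat_const; apply: leq_sum => q _.
  rewrite -sum1_card [X in _ <= X]big_mkcond [X in _ <= X](reindex_inj (mulgI (rot b q))) /=.
  by apply: leq_sum => p _; case: (_ \in S).
have intS : {in S &, forall p q : {perm 'I_(n b)}, exists x, p x = q x}.
  move=> p q; rewrite !inE => pS qS; have [|i /(_ b)] := good_meet pS qS; first by rewrite !ha.
  by rewrite !set_part_in; exists (vertex b i).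
have [|x [y eS]] := perm_star intS cS; first by rewrite card_ord.
have SE p : good F (set_part h p) = (p x == y) by have /setP/(_ p) := eS; rewrite !inE.
have hx : h b x = y by apply/eqP; rewrite -SE set_part_id.
(* The centre [x] is so far any vertex of part [b]. A good [u] agreeing with [h b] only at [x] must
   meet it at an index below [n a], so [x] is such an index. *)
have [|u uA uB] := @perm_avoid _ (h b) [set x] [:: h b].
  by rewrite cardsCs setCK cards1 card_ord /=; lia.
have uS : good F (set_part h u) by rewrite SE uA ?hx // inE.
have [|i /(_ b)] := good_meet uS hF; first exact: ha.
rewrite set_part_in => ei; exists i => p.
suff -> : vertex b i = x by rewrite SE hx.
apply/eqP; apply: contraT => nx.
by have := uB (vertex b i); rewrite inE => /(_ nx (h b) (mem_head _ _)); rewrite ei eqxx.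
Qed.

(** Change [h b] everywhere except at [i]: the diagonal stays good, and a member in it can meet [M]
    only in the edge of index [i]. *)
Lemma kernel_edge h M : M \in F -> M \subset act_set h diag ->
  forall i : 'I_(n a), 
    (forall p, good F (set_part h p) = (p (vertex b i) == h b (vertex b i))) ->
  act h (diag_edge i) \in M.
Proof.
move=> MF /subsetP sM i iP.
have [|u uA uB] := @perm_avoid _ (h b) [set vertex b i] [:: h b].
  by rewrite cardsCs setCK cards1 card_ord /=; lia.
have : good F (set_part h u) by rewrite iP uA // inE.
case/existsP => M' /andP[M'F /subsetP sM'].
have [e [eM eM']] := intF MF M'F.
have /imsetP[_ /imsetP[j _ ->] ej] := sM e eM.
have /imsetP[_ /imsetP[j' _ ->] ej'] := sM' e eM'.
move: ej'; rewrite ej => /ffunP E.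
have := E a; rewrite !ffunE dfwith_out // => /perm_inj/vertex_inj jj.
have := E b; rewrite !ffunE dfwith_in -jj => eb.
suff -> : i = j by rewrite -ej.
apply: (@vertex_inj b); apply/esym/eqP; apply: contraT => nx.
by have := uB (vertex b j); rewrite inE => /(_ nx (h b) (mem_head _ _)); rewrite eb eqxx.
Qed.

Lemma disjoint_through (T : finType) (x y x' y' : T) : 3 <= #|T| -> (x, y) != (x', y') ->
  exists p q : {perm T}, [/\ p x = y, q x' = y' & forall t, p t != q t].
Proof.
move=> T3 ne.
have [|p pA pB] := @perm_avoid _ (tperm x y) [set x] [:: tperm x' y'].
  by rewrite cardsCs setCK cards1 leq_subRL // (leq_trans _ T3).
have px : p x = y by rewrite pA ?tpermL // inE.
have px' : p x' != y'.
  have [e|nx] := eqVneq x' x.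
    by rewrite e px; apply: contraNneq ne => ->; rewrite e.
  by have := pB x'; rewrite inE => /(_ nx _ (mem_head _ _)); rewrite tpermL.
have [|q qA qB] := @perm_avoid _ (tperm x' y') [set x'] [:: p].
  by rewrite cardsCs setCK cards1 leq_subRL // (leq_trans _ T3).
have qx : q x' = y' by rewrite qA ?tpermL // inE.
exists p, q; split=> // t; rewrite eq_sym.
have [->|nt] := eqVneq t x'; first by rewrite qx eq_sym.
by apply: qB; rewrite ?inE ?mem_head.
Qed.

(** Different centres in part [b] would allow disjoint permutations through them, hence good
    diagonals that do not meet. With equal centres, two good diagonals agreeing in part [b] only at
    [i] share the edge of index [i], which fixes the other coordinates. *)
Lemma kernel_edge_unique h h' (i i' : 'I_(n a)) : h a = h' a ->
    (forall p, good F (set_part h p) = (p (vertex b i) == h b (vertex b i))) ->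
    (forall p, good F (set_part h' p) = (p (vertex b i') == h' b (vertex b i'))) ->
  act h (diag_edge i) = act h' (diag_edge i').
Proof.
move=> ha iP iP'.
have ha' p p' : set_part h p a = set_part h' p' a by rewrite !set_part_out // eq_sym.
have [eiy|ne] := eqVneq (vertex b i, h b (vertex b i))
  (vertex b i', h' b (vertex b i')); last first.
  have [|p [q [px qx pq]]] := disjoint_through _ ne; first by rewrite card_ord.
  have pF : good F (set_part h p) by rewrite iP px.
  have qF : good F (set_part h' q) by rewrite iP' qx.
  have [j /(_ b)] := good_meet pF qF (ha' _ _).
  by rewrite !set_part_in => e; have := pq (vertex b j); rewrite e eqxx.
have /vertex_inj ei := congr1 fst eiy; have /= ey := congr1 snd eiy.
rewrite -ei in iP' ey *.
have [|u uA uB] := @perm_avoid _ (h b) [set vertex b i] [:: h b].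
  by rewrite cardsCs setCK cards1 card_ord /=; lia.
have uF : good F (set_part h u) by rewrite iP uA // inE.
have hF : good F (set_part h' (h b)) by rewrite iP' ey.
have [j E] := good_meet uF hF (ha' _ _).
have ji : j = i.
  have := E b; rewrite !set_part_in => eb; apply: (@vertex_inj b); apply/eqP; apply: contraT => nx.
  by have := uB (vertex b j); rewrite inE => /(_ nx (h b) (mem_head _ _)); rewrite eb eqxx.
apply/ffunP => l; rewrite !ffunE; have [->|lb] := eqVneq l b; first exact: ey.
by have := E l; rewrite ji !set_part_out.
Qed.

(** Each edge is indexed by its vertex in part [a]. The normalisation [h a = 1] makes the diagonals
    of all members comparable. *)
Lemma extend_to_diag M : M \in matchings n r ->
  exists h, h a = 1%g /\ M \subset act_set h diag.
Proof.
case/matchingsP => cM iM.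
have ex l : exists p : {perm 'I_(n l)},
    {in M, forall x : edge n, p (vertex l (x a)) = x l} /\ (l = a -> p = 1%g).
  have [->|la] := eqVneq l a.
    by exists 1%g; split=> // x _; rewrite perm1 vertex_id.
  have [||p pP] := @perm_extend _ _ M (fun x : edge n => vertex l (x a)) (fun x : edge n => x l).
  - by move=> x y xM yM /vertex_inj; apply: iM.
  - by move=> x y xM yM; apply: iM.
  by exists p; split=> // e; rewrite e eqxx in la.
have [ps psP] := fin_all_exists ex.
exists [ffun l => ps l]; split; first by rewrite ffunE; have [_ ->] := psP a.
apply/subsetP => x xM; apply/imsetP; exists (diag_edge (x a)); first exact: imset_f.
by apply/ffunP => l; rewrite !ffunE; have [->] := psP l.
Qed.

Lemma extremal_sub_star : F \subset matchings n r -> exists e, F \subset star r e.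
Proof.
move=> sF.
have hP M : M \in F -> exists h (i : 'I_(n a)), [/\ h a = 1%g, act h (diag_edge i) \in M &
    forall p, good F (set_part h p) = (p (vertex b i) == h b (vertex b i))].
  move=> MF; have [h [ha sM]] := extend_to_diag (subsetP sF M MF).
  have hF : good F h by apply/existsP; exists M; rewrite MF.
  have [i iP] := good_set_part hF.
  by exists h, i; split=> //; apply: kernel_edge sM _ iP.
have [s [_ /existsP[M0 /andP[M0F _]]]] := allgood [ffun => 1%g].
have [h0 [i0 [h0a _ i0P]]] := hP M0 M0F.
exists (act h0 (diag_edge i0)); apply/subsetP => M MF.
have [h [i [ha eM iP]]] := hP M MF.
rewrite /star in_set (subsetP sF) //= (kernel_edge_unique _ i0P iP) //.
by rewrite h0a ha.
Qed.
End Extremal.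
End Frame.

(** * The bound and the case of equality *)

Section Main.
Variables (k r : nat) (n : 'I_k -> nat) (F : {set {set edge n}}).
Hypotheses (hk : 2 <= k) (hr : 1 <= r) (hn : forall i, r <= n i).
Hypotheses (hF : F \subset matchings n r) (hint : intersecting F).

Let npos i : 0 < n i. Proof. exact: leq_trans (hn i). Qed.

(** If the only part known to have three vertices is the smallest one [a], then all parts have
    three. *)
Lemma min_part : exists a b : 'I_k, [/\ b != a, forall l, n a <= n l &
  (exists l, 3 <= n l) -> 3 <= n b].
Proof.
have k0 : 0 < k by apply: leq_trans hk.
pose i0 := Ordinal k0; pose i1 := Ordinal hk.
have [a amin] : exists a, forall l, n a <= n l.
  exists [arg min_(l < i0) n l]; case: arg_minnP => // a _ H l; exact: H.
have [l3|no] := boolP [exists l, 3 <= n l].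
  have /existsP[l nl] := l3; have [la|la] := eqVneq l a; last by exists a, l.
  exists a, (if a == i0 then i1 else i0); split=> // [|_].
    by case: (a =P i0) => [->//|/eqP]; rewrite eq_sym.
  by rewrite la in nl; apply: leq_trans nl (amin _).
exists a, (if a == i0 then i1 else i0); split=> // [|l3].
  by case: (a =P i0) => [->//|/eqP]; rewrite eq_sym.
by case/negP: no; apply/existsP.
Qed.

Lemma intersecting_bound (e : edge n) : #|F| <= #|star r e| /\ 
  (#|F| = #|star r e| -> exists e' : edge n, F \subset star r e').
Proof.
have [a [b [ba amin b3]]] := min_part.
have [D [DX DP]] := katona_frame npos ba amin hr (hn a) hF hint.
have E0 : 0 < #|{: edge n}| by apply/card_gt0P; exists e.
have le g : #|[set e | act_set g (D e) \in F]| <= r by have [] := DP g.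
split.
  rewrite -(leq_pmul2r E0) card_star_mul; exact: average_le hF DX le.
move=> eqF.
have X0 : 0 < #|matchings n r| by apply/card_gt0P; exists (D e).
have cr g : #|[set e | act_set g (D e) \in F]| = r.
  by apply: average_eq => //; rewrite eqF card_star_mul.
have allgood g : exists s : edge n, s a = 0 :> nat /\ good a npos F (rotate npos g s).
  by have [_] := DP g; apply.
have [/existsP l3|/existsPn small] := boolP [exists l, 3 <= n l].
  exact: (extremal_sub_star ba amin hr (hn a) hint (b3 l3) allgood hF).
(* All parts have at most two vertices. Two members share an edge [x], and an edge disjoint from [x]
   is unique, so any edge of [M0] lies in every member. *)
have [s [_ /existsP[M0 /andP[M0F _]]]] := allgood [ffun => 1%g].
have [e0 [e0M _]] := hint M0F M0F.
exists e0; apply/subsetP => M MF; rewrite /star in_set (subsetP hF) //=.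
have [x [xM xM0]] := hint MF M0F.
have [->//|e0x] := eqVneq e0 x.
have [cM iM] := matchingsP _ _ (subsetP hF M MF).
have [cM0 iM0] := matchingsP _ _ (subsetP hF M0 M0F).
have : 1 < #|M0| by apply/card_gt1P; exists e0, x.
rewrite cM0 -cM (cardsD1 x M) xM ltnS => /card_gt0P[y]; rewrite !inE => /andP[yx yM].
suff -> : e0 = y by [].
apply/ffunP => l; apply: ord_inj.
have ne (z : edge n) (N : {set edge n}) : z != x ->
    (forall e f : edge n, e \in N -> f \in N -> forall i, e i = f i -> e = f) ->
    z \in N -> x \in N -> z l <> x l :> nat.
  by move=> zx iN zN xN /val_inj/(iN _ _ zN xN)/eqP; rewrite (negPf zx).
have := ne _ _ yx iM yM xM; have := ne _ _ e0x iM0 e0M xM0.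
have := small l; have := ltn_ord (y l); have := ltn_ord (e0 l); have := ltn_ord (x l).
move: (nat_of_ord (y l)) (nat_of_ord (e0 l)) (nat_of_ord (x l)) => yl el xl; lia.
Qed.
End Main.

Import Order.TTheory GRing.Theory Num.Theory.
Local Open Scope ring_scope.

Theorem theorem1p3 (k r : nat) (n : 'I_k -> nat) (F : {set {set edge n}})
    (hk : (2 <= k)%N) (hr : (1 <= r)%N) (hn : forall i : 'I_k, (r <= n i)%N)
    (hF : F \subset matchings n r) (hint : intersecting F) :
  let bound : rat :=
    (\prod_(i < k) ((n i - 1) ^_ (r - 1))%:R) / ((r - 1)`!)%:R in
  (#|F|)%:R <= bound /\ ((#|F|)%:R = bound <-> is_star r F).
Proof.
move=> bound.
have npos i : (0 < n i)%N by apply: leq_trans (hn i).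
pose e0 : edge n := [ffun i => Ordinal (npos i)].
have k0 : (0 < k)%N by apply: leq_trans hk.
(* All stars have the same size, so any edge [e0] can represent the bound. *)
have -> : bound = (#|star r e0|)%:R.
  rewrite /bound -natr_prod; apply: canLR (mulfK _) _.
    by rewrite pnatr_eq0 -lt0n fact_gt0.
  rewrite -natrM subn1 (card_star (Ordinal k0) e0 hr npos); congr (_%:R).
  by apply: eq_bigr => i _; rewrite !subn1.
have [le eq] := intersecting_bound hk hr hn hF hint e0.
split; first by rewrite ler_nat.
split=> [/eqP|[e ->]]; last by rewrite (card_star_const r e e0).
rewrite eqr_nat => /eqP eF; have [e sF] := eq eF; exists e.
by apply/eqP; rewrite eqEcard sF eF (card_star_const r e0 e) leqnn.
Qed.
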